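(* Let $f \in \operatorname{Sym}^d \mathbb{C}^{n+1}$ be a nonzero homogeneous polynomial such that its apolar ideal $f^\perp$ is generated in degree $\delta$. (1) If, for every $k \geq 1$, the tensor $f^{\otimes k} \in (\operatorname{Sym}^d \mathbb{C}^{n+1})^{\otimes k}$ satisfies condition $(\star)$, i.e. $\mathrm{R}_{\mathbf d}(f^{\otimes k}) \geq \frac{\dim A_{f^{\otimes k}}}{\delta^k}$ with $\mathbf d=(d,\dots,d)$, then $\underline{\mathrm{R}}_d(f) \geq \frac{\dim A_f}{\delta}$. (2) If, for every $k \geq 1$, the tensor $f^{\otimes k}$ satisfies condition $(\star_c)$, i.e. $\mathrm{cR}_{\mathbf d}(f^{\otimes k}) \geq \frac{\dim A_{f^{\otimes k}}}{\delta^k}$, then $\underline{\mathrm{cR}}_d(f) \geq \frac{\dim A_f}{\delta}$.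
   Context: All vector spaces are finite-dimensional over $\mathbb{C}$. For vector spaces $V_1,\dots,V_k$ and $\mathbf d=(d_1,\dots,d_k)$, an element $t\in \operatorname{Sym}^{d_1}V_1\otimes\cdots\otimes \operatorname{Sym}^{d_k}V_k$ is a partially symmetric tensor of multidegree $\mathbf d$; it is identified with a multihomogeneous polynomial in $\operatorname{Sym}^\bullet(V_1\oplus\cdots\oplus V_k)\simeq \operatorname{Sym}^\bullet V_1\otimes\cdots\otimes\operatorname{Sym}^\bullet V_k$. The case $k=1$ is that of homogeneous polynomials. In particular $f^{\otimes k}$ has multidegree $(d,\dots,d)$ and is the product of $k$ copies of $f$ in disjoint sets of variables. Ranks. Let $\nu_{\mathbf d}:\mathbb{P}V_1\times\cdots\times\mathbb{P}V_k\to\mathbb{P}(\operatorname{Sym}^{d_1}V_1\otimes\cdots\otimes\operatorname{Sym}^{d_k}V_k)$, $([\ell_1],\dots,[\ell_k])\mapsto[\ell_1^{d_1}\otimes\cdots\otimes\ell_k^{d_k}]$ be the Segre-Veronese embedding. The partially symmetric rank is $\mathrm{R}_{\mathbf d}(t)=\min\{r: t=\sum_{j=1}^r \ell_{1,j}^{d_1}\otimes\cdots\otimes\ell_{k,j}^{d_k},\ \ell_{i,j}\in V_i\}$. The cactus rank $\mathrm{cR}_{\mathbf d}(t)$ is the minimal $r$ such that there is a $0$-dimensional scheme $S\subset\mathbb{P}V_1\times\cdots\times\mathbb{P}V_k$ of length $r$ with $[t]\in\langle\nu_{\mathbf d}(S)\rangle$ (linear span of the scheme). For $k=1$ these are the Waring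 rank $\mathrm{R}_d(f)$ and the cactus rank $\mathrm{cR}_d(f)$. The border rank $\underline{\mathrm{R}}_d(f)$ (resp. border cactus rank $\underline{\mathrm{cR}}_d(f)$) is the minimal $r$ such that there is a family $(f_\varepsilon)_{\varepsilon>0}\subset\operatorname{Sym}^d\mathbb{C}^{n+1}$ with $f=\lim_{\varepsilon\to0}f_\varepsilon$ and $\mathrm{R}_d(f_\varepsilon)=r$ (resp. $\mathrm{cR}_d(f_\varepsilon)=r$) for all $\varepsilon$. Apolarity. $\operatorname{Sym}^\bullet(V_1^*\oplus\cdots\oplus V_k^* )$ acts on $\operatorname{Sym}^\bullet(V_1\oplus\cdots\oplus V_k)$ as differential operators with constant coefficients (dual basis elements act as partial derivatives). The apolar ideal of $t$ is $t^\perp=\{D: D(t)=0\}$, a multihomogeneous ideal of $\operatorname{Sym}^\bullet(V_1^*\oplus\cdots\oplus V_k^* )$, and the apolar algebra is $A_t=\operatorname{Sym}^\bullet(V_1^*\oplus\cdots\oplus V_k^* )/t^\perp$, which is a finite-dimensional vector space. A (multi)homogeneous ideal is said to be generated in (multi)degree $\boldsymbol\delta=(\delta_1,\dots,\delta_k)$ if it is generated by multihomogeneous elements of multidegree at most $\boldsymbol\delta$ componentwise. If $f^\perp$ is generated in degree $\delta$, then $(f^{\otimes k})^\perp$ is generated in multidegree $(\delta,\dots,\delta)$. Conditions. A tensor $t$ whose apolar ideal is generated in multidegree $\boldsymbol\delta=(\delta_1,\dots,\delta_k)$ satisfies condition $(\star)$ if $\mathrm{R}_{\mathbf d}(t)\ge\frac{\dim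 A_t}{\delta_1\cdots\delta_k}$, and condition $(\star_c)$ if $\mathrm{cR}_{\mathbf d}(t)\ge\frac{\dim A_t}{\delta_1\cdots\delta_k}$. *)

(* Defs.v *)
(* The base field is C = R[i] for R : realType.  multinomials is imported before
   the analysis files because the opposite order makes their notations clash. *)
From HB Require Import structures.
From mathcomp Require Import all_boot all_order all_algebra.
From mathcomp Require Import complex mpoly.
From mathcomp Require Import boolp classical_sets functions reals ereal.
From mathcomp Require Import topology normedtype.

Set Implicit Arguments.
Unset Strict Implicit.
Unset Printing Implicit Defensive.

Import Order.TTheory GRing.Theory Num.Theory.
Import numFieldNormedType.Exports.

Local Open Scope classical_set_scope.
Local Open Scope ring_scope.

(* Spaces V_1, ..., V_k are encoded by a map b : 'I_N -> 'I_k from the N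
   coordinates of V_1 + ... + V_k to blocks: {j | b j = i} indexes a basis of
   V_i.  The ring {mpoly R[i][N]} plays both the role of Sym(V_1 + ... + V_k)
   and, via the dual basis, that of Sym(V_1^* + ... + V_k^* ), which is also
   the Cox ring of P V_1 x ... x P V_k. *)
Section PartiallySymmetricTensors.
Variables (R : realType) (N k : nat) (b : 'I_N -> 'I_k).
Local Notation C := R[i].
Local Notation poly := {mpoly C[N]}.

Definition block_deg (m : 'X_{1..N}) (i : 'I_k) : nat :=
  (\sum_(j < N | b j == i) m j)%N.

Definition multihomog (u : 'I_k -> nat) : set poly :=
  [set p | forall m, m \in msupp p -> forall i, block_deg m i = u i].

Definition linear_forms (i : 'I_k) : set poly :=
  [set l | exists a : 'I_N -> C, l = \sum_(j < N | b j == i) a j *: 'X_j].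

(* The minimum of A, with value +oo when A is empty. *)
Definition minlength (A : set nat) : \bar R := ereal_inf [set r%:R%:E | r in A].

Definition ps_rank (d : 'I_k -> nat) (t : poly) : \bar R :=
  minlength [set r | exists l : 'I_r -> 'I_k -> poly,
    (forall s i, linear_forms i (l s i)) /\
    t = \sum_(s < r) \prod_(i < k) l s i ^+ d i].

Definition ideal_span (G : set poly) : set poly :=
  [set p | exists (r : nat) (h g : 'I_r -> poly),
    (forall s, G (g s)) /\ p = \sum_(s < r) h s * g s].

Definition multihomog_ideal (I : set poly) : Prop :=
  exists G : set poly,
    (forall g, G g -> exists u, multihomog u g) /\ I = ideal_span G.

Definition generated_in (delta : 'I_k -> nat) (I : set poly) : Prop :=
  exists G : set poly,
    (forall g, G g -> exists2 u, multihomog u g &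
                        forall i, (u i <= delta i)%N) /\
    I = ideal_span G.

(* For linear subspaces U and I, dim (U / (U `&` I)) = r: the classes of
   e_1, ..., e_r form a basis of the quotient. *)
Definition quotient_dim (U I : set poly) (r : nat) : Prop :=
  exists e : 'I_r -> poly, (forall s, U (e s)) /\
    forall p, U p -> exists! c : 'rV[C]_r, I (p - \sum_(s < r) c 0 s *: e s).

Definition apolar_action (D t : poly) : poly :=
  \sum_(m <- msupp D) D@_m *: t^`M[m].

Definition apolar_ideal (t : poly) : set poly :=
  [set D | apolar_action D t = 0].

(* The apolar algebra of a polynomial is finite-dimensional, so the default
   value 0 of xget is never used. *)
Definition apolar_dim (t : poly) : nat :=
  xget 0%N [set r | quotient_dim setT (apolar_ideal t) r].

(* (I : B) is contained in I, where B is the irrelevant ideal of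
   P V_1 x ... x P V_k, generated by the products of k variables, one from each
   block. *)
Definition saturated (I : set poly) : Prop :=
  forall p, (forall v : 'I_k -> 'I_N, (forall i, b (v i) = i) ->
               I ((\prod_(i < k) 'X_(v i)) * p)) -> I p.

(* Closed subschemes of P V_1 x ... x P V_k correspond bijectively to saturated
   multihomogeneous ideals of the Cox ring.  The scheme is 0-dimensional of
   length r (or empty, when r = 0) iff its Hilbert polynomial is the constant r,
   i.e. the Hilbert function takes the value r in all large multidegrees. *)
Definition zero_dim_scheme (r : nat) (I : set poly) : Prop :=
  [/\ multihomog_ideal I, saturated I &
      exists u0 : 'I_k -> nat, forall u : 'I_k -> nat,
        (forall i, (u0 i <= u i)%N) -> quotient_dim (multihomog u) I r].

(* A hyperplane of P(Sym^d1 V_1 * ... * Sym^dk V_k) is a form D of multidegree d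
   up to scalars; it contains nu_d(S) iff D vanishes on S, i.e. D lies in the
   ideal I of S, and it contains [t] iff D(t) = 0.  The linear span of nu_d(S)
   is the intersection of the hyperplanes that contain nu_d(S). *)
Definition in_scheme_span (d : 'I_k -> nat) (I : set poly) (t : poly) : Prop :=
  forall D, I D -> multihomog d D -> apolar_action D t = 0.

Definition cactus_rank (d : 'I_k -> nat) (t : poly) : \bar R :=
  minlength [set r | exists I, zero_dim_scheme r I /\ in_scheme_span d I t].

End PartiallySymmetricTensors.

Section HomogeneousPolynomials.
Variables (R : realType) (N : nat).
Local Notation C := R[i].
Local Notation poly := {mpoly C[N]}.

Definition one_block : 'I_N -> 'I_1 := fun=> ord0.

Definition waring_rank (d : nat) (f : poly) : \bar R :=
  ps_rank one_block (fun=> d) f.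

Definition waring_cactus_rank (d : nat) (f : poly) : \bar R :=
  cactus_rank one_block (fun=> d) f.

(* Limits in the finite-dimensional space Sym^d C^N are taken coefficientwise;
   C^o is C with the topology given by its norm. *)
Definition border (rk : poly -> \bar R) (d : nat) (f : poly) : \bar R :=
  minlength R [set r | exists F : R -> poly,
    (forall e, 0 < e -> F e \is d.-homog /\ rk (F e) = r%:R%:E) /\
    forall m, ((F e)@_m : C^o) @[e --> 0^'+] --> (f@_m : C^o)].

Definition border_rank (d : nat) (f : poly) : \bar R :=
  border (waring_rank d) d f.

Definition border_cactus_rank (d : nat) (f : poly) : \bar R :=
  border (waring_cactus_rank d) d f.

End HomogeneousPolynomials.

Section TensorPower.
Variables (R : realType) (N k : nat).
Local Notation C := R[i].

(* The variables of the i-th copy of C^N are 'X_(mxvec_index i j), j < N. *)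
Definition copy_block (v : 'I_(k * N)) : 'I_k :=
  (enum_val (cast_ord (esym (mxvec_cast k N)) v)).1.

Lemma copy_block_index (i : 'I_k) (j : 'I_N) :
  copy_block (mxvec_index i j) = i.
Proof. by rewrite /copy_block /mxvec_index cast_ordK enum_rankK. Qed.

Definition tensor_power (f : {mpoly C[N]}) : {mpoly C[k * N]} :=
  \prod_(i < k) (f \mPo [tuple 'X_(mxvec_index i j) | j < N]).

End TensorPower.

(* Main.v *)
Require Import Defs.
From HB Require Import structures.
From mathcomp Require Import all_boot all_order all_algebra.
From mathcomp Require Import complex mpoly.
From mathcomp Require Import boolp classical_sets functions reals ereal.
From mathcomp Require Import topology normedtype.
From mathcomp Require Import ssrcomplements.
From mathcomp Require Import ring zify.

Set Implicit Arguments.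
Unset Strict Implicit.
Unset Printing Implicit Defensive.

Import Order.TTheory GRing.Theory Num.Theory.
Import numFieldNormedType.Exports.

Local Open Scope ring_scope.

(** The proof compares the growth in k of the two sides of the hypothesis for
the power f^k, the product of k copies of f in disjoint variables.

- The apolar algebra of f^k is the k-th tensor power of that of f, so its
  dimension is at least (dim A_f)^k (apolar_dim_tensor_power).
- If f is a limit of forms of rank r, then the rank of f^k is at most
  P(k) r^k with P a polynomial.  No curve of forms through f is needed: the
  coefficients of g^k are monomials of degree k in the coefficients of g, so
  the powers g^k span a space of dimension at most (k + 1)^D, where D is the
  number of monomials of degree at most d.  A linear relation among these
  monomials that holds along the family holds for f in the limit; hence f^k is
  a linear combination of at most (k + 1)^D powers g^k with g in the family
  (border_tensor_power).  Each of them has rank at most r^k.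

Together, (dim A_f)^k <= (k + 1)^D (r delta)^k for all k >= 1, and since an
exponential outgrows a polynomial, dim A_f <= r delta (subexponential_root).

The rank of a linear combination of M powers is at most M r^k by expanding
products (ps_rank_sum_powers).  For the cactus rank the corresponding scheme
is the union of the products S_i^k, where S_i has length r and spans a space
containing g_i (cactus_rank_sum_powers).  Its ideal has to be saturated with
an eventually constant Hilbert function, and this is obtained in coordinates.
A scheme S of length r in projective space, whose span contains a form g of
degree d, misses some hyperplane l = 0, so it is the spectrum of an
r-dimensional algebra; in terms of matrices, there are a map E from monomials
to row vectors of size r and matrices A_v with E(x_v m) = E(m) A_v and
l(A) = 1, such that the pairing of the forms of degree d with g factors through
E (exists_scheme_coordinates).  Such coordinates multiply and add up, and
conversely any finite family of linear functionals whose common kernel is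
stable under the variables, and for which a linear form of each block acts as
the identity, defines a zero-dimensional scheme of length at most the number of
functionals (zero_dim_scheme_of_functionals).

A form l that does not vanish on S is found on the curve of forms
l_t = sum_v t^v x_v.  By McCoy's theorem the generic member of this curve is
not a zero divisor modulo the saturated ideal of S (mccoy), so multiplication
by l_t between two consecutive large degrees has a determinant that is a nonzero
polynomial in t (exists_chart); the same t can then be chosen for finitely many
schemes. *)

(** * Linear algebra *)

Section SpanningFamilies.
Variable F : fieldType.

(** A basis of the span of a possibly infinite family can be extracted from the
family itself: take a free subfamily of maximal size. *)
Lemma free_spanning_family N (X : Type) (P : X -> Prop) (y : X -> 'rV[F]_N) :
  exists s (x : 'I_s -> X),
    [/\ forall i, P (x i), row_free (\matrix_i y (x i)) &
        forall z, P z -> (y z <= \matrix_i y (x i))%MS].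
Proof.
pose Q s := exists x : 'I_s -> X,
  (forall i, P (x i)) /\ row_free (\matrix_i y (x i)).
have Q0 : exists s, `[< Q s >].
  exists 0%N; apply/asboolP.
  have x0 : 'I_0 -> X by case.
  by exists x0; split; [case | rewrite /row_free -leqn0 rank_leq_row].
have Qle s : `[< Q s >] -> (s <= N)%N.
  by move=> /asboolP [x [_ /eqP <-]]; apply: rank_leq_col.
case: (ex_maxnP Q0 Qle) => s /asboolP [x [Px fx]] smax.
exists s, x; split=> // z Pz; apply/negPn/negP => nz.
have /smax : `[< Q s.+1 >]; last by rewrite ltnn.
apply/asboolP; exists (fun i => oapp x z (unlift ord0 i)); split.
  by move=> i; case: unliftP => [j|] _ /=.
apply: inj_row_free => v; rewrite mulmx_sum_row big_ord_recl.
under eq_bigr do rewrite rowK liftK /=.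
rewrite rowK unlift_none /=.
have -> : \sum_i v 0 (lift ord0 i) *: y (x i)
    = (\row_i v 0 (lift ord0 i)) *m \matrix_i y (x i).
  by rewrite mulmx_sum_row; apply: eq_bigr => i _; rewrite rowK mxE.
move=> h; have v0 : v 0 ord0 = 0.
  apply/eqP/negPn/negP => v0; case/negP: nz; apply/submxP.
  exists (- (v 0 ord0)^-1 *: \row_i v 0 (lift ord0 i)).
  rewrite -scalemxAl; apply: (scalerI v0); rewrite scalerA mulrN divff //.
  by rewrite scaleN1r; apply/eqP; rewrite -addr_eq0 h.
move: h; rewrite v0 scale0r add0r => /eqP; rewrite mulmx_free_eq0 // => /eqP h.
apply/rowP => i; rewrite mxE; case: (unliftP ord0 i) => [j|] -> //.
by move/rowP: h => /(_ j); rewrite !mxE.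
Qed.

(** A function h on a finite set factors linearly through vectors e as soon as
h satisfies every linear relation between the e i. *)
Lemma factor_through r (I : finType) (e : I -> 'rV[F]_r) (h : I -> F) :
  (forall c : I -> F, \sum_i c i *: e i = 0 -> \sum_i c i * h i = 0) ->
  exists psi : 'cV[F]_r, forall i, h i = (e i *m psi) 0 0.
Proof.
move=> ker; pose M := \matrix_(s < r, i < #|I|) e (enum_val i) 0 s.
pose hr : 'rV_#|I| := \row_i h (enum_val i).
have sumE (G : I -> F) : \sum_i G i = \sum_(i < #|I|) G (enum_val i).
  by rewrite (reindex _ (onW_bij _ (enum_val_bij I))).
have : (hr <= M)%MS.
  rewrite submxE; apply/eqP/rowP => j; rewrite !mxE.
  pose c i := cokermx M (enum_rank i) j.
  transitivity (\sum_i c i * h i).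
    rewrite sumE; apply: eq_bigr => i _.
    by rewrite mxE /c enum_valK mulrC.
  apply: ker; apply/rowP => s; rewrite summxE [RHS]mxE.
  transitivity ((M *m cokermx M) s j); last by rewrite mulmx_coker mxE.
  rewrite [RHS]mxE (reindex _ (onW_bij _ (enum_val_bij I))).
  apply: eq_bigr => i _.
  by rewrite mxE [M _ _]mxE /c enum_valK mulrC.
case/submxP => D hD; exists D^T => i.
move/rowP: hD => /(_ (enum_rank i)); rewrite !mxE enum_rankK => ->.
by apply: eq_bigr => s _; rewrite !mxE enum_rankK mulrC.
Qed.

End SpanningFamilies.

(** * Linear maps on polynomials given by their values on monomials *)

Section LinearExtension.
Variables (n : nat) (K : fieldType).
Implicit Types (p : {mpoly K[n]}) (m : 'X_{1..n}).

Definition mlift (V : lmodType K) (v : 'X_{1..n} -> V) p : V :=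
  \sum_(m <- msupp p) p@_m *: v m.

Lemma mliftwE (V : lmodType K) (v : 'X_{1..n} -> V) p k : (msize p <= k)%N ->
  mlift v p = \sum_(m : 'X_{1..n < k}) p@_m *: v m.
Proof.
move=> le_pk; pose I : subFinType _ := 'X_{1..n < k}.
rewrite /mlift (big_mksub I) ?msupp_uniq //=; first last.
  by move=> x /msize_mdeg_lt /leq_trans; apply.
by rewrite big_rmcond //= => i /memN_msupp_eq0 ->; rewrite scale0r.
Qed.

Lemma mlift_is_linear (V : lmodType K) (v : 'X_{1..n} -> V) : linear (mlift v).
Proof.
move=> c p q; pose k := maxn (msize (c *: p + q)) (maxn (msize p) (msize q)).
have [h1 [h2 h3]] : (msize (c *: p + q) <= k)%N /\
  (msize p <= k)%N /\ (msize q <= k)%N by rewrite /k; lia.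
rewrite !(@mliftwE _ _ _ k) //.
rewrite scaler_sumr -big_split; apply: eq_bigr => m _ /=.
by rewrite mcoeffD mcoeffZ scalerDl scalerA.
Qed.

HB.instance Definition _ (V : lmodType K) (v : 'X_{1..n} -> V) :=
  GRing.isLinear.Build K {mpoly K[n]} V _ (mlift v) (@mlift_is_linear V v).

Lemma mlift0 (V : lmodType K) (v : 'X_{1..n} -> V) : mlift v 0 = 0.
Proof. exact: linear0. Qed.

Lemma mliftD (V : lmodType K) (v : 'X_{1..n} -> V) :
  {morph mlift v : p q / p + q}.
Proof. exact: linearD. Qed.

Lemma mliftZ (V : lmodType K) (v : 'X_{1..n} -> V) c p :
  mlift v (c *: p) = c *: mlift v p.
Proof. exact: linearZ. Qed.

Lemma mlift_sum (V : lmodType K) (v : 'X_{1..n} -> V) (I : Type) (r : seq I)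
    (P : pred I) (f : I -> {mpoly K[n]}) :
  mlift v (\sum_(i <- r | P i) f i) = \sum_(i <- r | P i) mlift v (f i).
Proof. exact: linear_sum. Qed.

Lemma mliftX (V : lmodType K) (v : 'X_{1..n} -> V) m : mlift v 'X_[m] = v m.
Proof. by rewrite /mlift msuppX big_seq1 mcoeffX eqxx scale1r. Qed.

Lemma mliftXM (V : lmodType K) (v : 'X_{1..n} -> V) m p :
  mlift v ('X_[m] * p) = mlift (fun m' => v (m + m')%MM) p.
Proof.
rewrite {1}[p]mpolyE mulr_sumr linear_sum; apply: eq_bigr => m' _.
by rewrite -scalerAr -mpolyXD linearZ /= mliftX.
Qed.

Lemma eq_mlift (V : lmodType K) (v w : 'X_{1..n} -> V) p :
  (forall m, m \in msupp p -> v m = w m) -> mlift v p = mlift w p.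
Proof. by move=> vw; apply: eq_big_seq => m /vw ->. Qed.

End LinearExtension.

(** * Multigraded components and dimensions of quotients *)

Section Grading.
Variables (R : realType) (N k : nat) (b : 'I_N -> 'I_k).
Local Notation C := R[i].
Local Notation poly := {mpoly C[N]}.
Implicit Types (p q : poly) (m : 'X_{1..N}) (u : 'I_k -> nat).

Lemma block_degD m1 m2 i :
  block_deg b (m1 + m2) i = (block_deg b m1 i + block_deg b m2 i)%N.
Proof.
by rewrite /block_deg -big_split; apply: eq_bigr => j _; rewrite mnmDE.
Qed.

Lemma block_degU v i : block_deg b U_(v) i = (b v == i).
Proof.
rewrite /block_deg; have [bvi|bvi] := eqVneq (b v) i.
  rewrite (bigD1 v) ?bvi //= mnm1E eqxx big1 // => j /andP[_ jv].
  by rewrite mnm1E eq_sym (negbTE jv).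
rewrite big1 // => j /eqP bji; rewrite mnm1E; case: eqP => // vj.
by rewrite vj bji eqxx in bvi.
Qed.

Lemma mdeg_block_deg m : mdeg m = (\sum_i block_deg b m i)%N.
Proof.
rewrite mdegE (partition_big b xpredT) //=.
Qed.

Definition has_deg u m := [forall i, block_deg b m i == u i].

Lemma has_degP u m : reflect (forall i, block_deg b m i = u i) (has_deg u m).
Proof. exact: 'forall_eqP. Qed.

Definition component u : poly -> poly :=
  mlift (fun m => if has_deg u m then 'X_[m] else 0).

HB.instance Definition _ u := GRing.Linear.on (component u).

Lemma componentX u m : component u 'X_[m] = if has_deg u m then 'X_[m] else 0.
Proof. exact: mliftX. Qed.

Lemma mcoeff_component u p m :
  (component u p)@_m = if has_deg u m then p@_m else 0.
Proof.
rewrite /component /mlift raddf_sum /=.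
have E m' : (p@_m' *: (if has_deg u m' then 'X_[m'] else 0 : poly))@_m
    = if m' == m then (if has_deg u m then p@_m else 0) else 0.
  rewrite mcoeffZ; have [->|ne] := eqVneq m' m.
    by case: ifP; rewrite ?mcoeffX ?eqxx ?mcoeff0 ?mulr1 ?mulr0.
  by case: ifP; rewrite ?mcoeffX ?(negbTE ne) ?mcoeff0 ?mulr0.
under eq_bigr do rewrite E.
have [mp|mp] := boolP (m \in msupp p).
  rewrite (bigD1_seq m) ?msupp_uniq //= eqxx big1 ?addr0 // => m'.
  by move/negbTE ->.
rewrite (memN_msupp_eq0 mp) big1 => [|m' _]; first by case: ifP.
by case: ifP => //; case: ifP.
Qed.

Lemma component_multihomog u p : multihomog b u (component u p).
Proof.
move=> m; rewrite mcoeff_msupp mcoeff_component.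
by case: has_degP => //; rewrite eqxx.
Qed.

Lemma component_id u p : multihomog b u p -> component u p = p.
Proof.
move=> hp; apply/mpolyP => m; rewrite mcoeff_component.
case: has_degP => // nm; apply/esym/memN_msupp_eq0.
by apply/negP => /hp.
Qed.

Lemma multihomog_linear u c p q :
  multihomog b u p -> multihomog b u q -> multihomog b u (c *: p + q).
Proof.
move=> hp hq m /msuppD_le; rewrite mem_cat => /orP[/msuppZ_le|].
  exact: hp.
exact: hq.
Qed.

Lemma multihomog0 u : multihomog b u (0 : poly).
Proof. by move=> m; rewrite msupp0. Qed.

Lemma multihomog_sum u (T : Type) (r : seq T) (c : T -> C) (e : T -> poly) :
  (forall s, multihomog b u (e s)) -> multihomog b u (\sum_(s <- r) c s *: e s).
Proof.
move=> he; elim/big_rec: _ => [|s x _ hx]; first exact: multihomog0.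
exact: multihomog_linear.
Qed.

Lemma multihomogXM u m p : multihomog b u p ->
  multihomog b (fun i => block_deg b m i + u i)%N ('X_[m] * p).
Proof.
move=> hp m' /msuppM_le /allpairsP [[m1 m2] /= [h1 h2 ->]] i.
by move: h1; rewrite msuppX inE => /eqP ->; rewrite block_degD (hp _ h2).
Qed.

Lemma sum_components p :
  exists r (u : 'I_r -> 'I_k -> nat), p = \sum_s component (u s) p.
Proof.
pose md m : {ffun 'I_k -> nat} := [ffun i => block_deg b m i].
pose us := undup [seq md m | m <- msupp p].
exists (size us), (fun s => nth [ffun => 0%N] us s).
rewrite -(big_mkord xpredT (fun s => component (nth [ffun => 0%N] us s) p)).
rewrite -(big_nth _ xpredT (fun u : {ffun 'I_k -> nat} => component u p)).
apply/mpolyP => m; rewrite raddf_sum /=.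
have hd (u : {ffun 'I_k -> nat}) : has_deg u m = (md m == u).
  apply/has_degP/eqP => [h|<- i]; last by rewrite ffunE.
  by apply/ffunP => i; rewrite ffunE.
under eq_bigr do rewrite mcoeff_component hd.
have [mp|mp] := boolP (m \in msupp p); last first.
  by rewrite (memN_msupp_eq0 mp) big1 // => u _; case: ifP.
have mu : md m \in us by rewrite mem_undup; apply: map_f.
rewrite (bigD1_seq (md m)) ?undup_uniq //= eqxx big1 ?addr0 // => u.
by rewrite eq_sym => /negbTE ->.
Qed.

Lemma componentXM u m p : (forall i, block_deg b m i <= u i)%N ->
  component u ('X_[m] * p) =
  'X_[m] * component (fun i => u i - block_deg b m i)%N p.
Proof.
move=> le_mu; rewrite {1}[p]mpolyE [in RHS](mpolyE p).
rewrite mulr_sumr !linear_sum mulr_sumr; apply: eq_bigr => m' _ /=.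
rewrite -scalerAr -mpolyXD !linearZ /= -scalerAr !componentX.
have -> : has_deg u (m + m') = has_deg (fun i => u i - block_deg b m i)%N m'.
  apply/has_degP/has_degP => h i; move: (h i) (le_mu i);
    rewrite block_degD; lia.
by case: ifP; rewrite ?mulr0 // mpolyXD.
Qed.

Lemma componentXM0 u m p : ~ (forall i, block_deg b m i <= u i)%N ->
  component u ('X_[m] * p) = 0.
Proof.
move=> le_mu; rewrite [p]mpolyE mulr_sumr linear_sum big1 // => m' _ /=.
rewrite -scalerAr -mpolyXD linearZ /= componentX.
case: has_degP; rewrite ?scaler0 // => h; case: le_mu => i.
by rewrite -h block_degD leq_addr.
Qed.

End Grading.

Section QuotientDim.
Variables (R : realType) (N : nat).
Local Notation C := R[i].
Local Notation poly := {mpoly C[N]}.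
Implicit Types (U I : set poly).

Definition linear_closed U := forall s (c : 'I_s -> C) (e : 'I_s -> poly) p,
  U p -> (forall i, U (e i)) -> U (p - \sum_i c i *: e i).

Lemma rowsum_mul m s (c : 'rV[C]_s) (y : 'I_s -> 'rV[C]_m) :
  \sum_i c 0 i *: y i = c *m \matrix_i y i.
Proof. by rewrite mulmx_sum_row; apply: eq_bigr => i _; rewrite rowK. Qed.

(** If I is cut out in U by a linear map Phi to a space of row vectors, then
U modulo I is the image of U under Phi, and a basis of this image lifts. *)
Lemma quotient_dim_free M (Phi : {linear poly -> 'rV[C]_M}) U I s
    (e : 'I_s -> poly) :
  linear_closed U ->
  (forall p, U p -> I p <-> Phi p = 0) ->
  (forall i, U (e i)) -> row_free (\matrix_i Phi (e i)) ->
  (forall p, U p -> (Phi p <= \matrix_i Phi (e i))%MS) ->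
  quotient_dim U I s.
Proof.
move=> Ucl UI Ue free_e span_e; exists e; split=> // p Up.
have PhiE (c : 'rV[C]_s) : Phi (p - \sum_i c 0 i *: e i) =
    Phi p - c *m \matrix_i Phi (e i).
  rewrite linearB linear_sum /=; under eq_bigr do rewrite linearZ /=.
  by rewrite rowsum_mul.
have /submxP [c hc] := span_e _ Up.
exists c; split; first by apply/UI; [exact: Ucl|rewrite PhiE hc subrr].
move=> c' /UI; rewrite PhiE => /(_ (Ucl _ (c' 0) _ _ Up Ue)) /eqP.
rewrite subr_eq0 => /eqP h; apply: (row_free_inj free_e); by rewrite -hc.
Qed.

End QuotientDim.

(** * The apolar pairing *)

Section ApolarPairing.
Variables (R : realType) (N : nat).
Local Notation C := R[i].
Local Notation poly := {mpoly C[N]}.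
Implicit Types (t D : poly) (m : 'X_{1..N}).

Definition mfact m : C := (\prod_i (m i)`!)%:R.

Lemma mfact_neq0 m : mfact m != 0.
Proof.
rewrite pnatr_eq0 -lt0n prodn_gt0 // => i; exact: fact_gt0.
Qed.

(** The coefficient of t in the basis of divided powers, dual to the monomial
differential operators. *)
Definition divpow_coef t m : C := mfact m * t@_m.

(** The pairing of D * X^m with t: differentiation acts on divided powers by
shifting exponents, so only the function divpow_coef t enters. *)
Lemma mcoeff_apolar D t m :
  mfact m * (apolar_action D t)@_m =
  mlift (fun m' => divpow_coef t (m' + m) : C^o) D.
Proof.
rewrite /apolar_action /mlift raddf_sum mulr_sumr; apply: eq_bigr => m' _ /=.
rewrite mcoeffZ mcoeff_mderivm -mulr_natr /divpow_coef.
have <- : mfact m * (\prod_i ((m' + m)%MM i) ^_ (m' i))%:R = mfact (m' + m).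
  rewrite /mfact -natrM -big_split /=; congr (_%:R); apply: eq_bigr => i _.
  by rewrite mnmDE mulnC -[in RHS](ffact_fact (leq_addr (m i) (m' i))) addKn.
rewrite -[RHS]/(_ * _); ring.
Qed.

Lemma apolar_idealP D t :
  apolar_ideal t D <->
  forall m, mlift (fun m' => divpow_coef t (m' + m) : C^o) D = 0.
Proof.
split=> [h m|h]; first by rewrite -mcoeff_apolar h mcoeff0 mulr0.
apply/mpolyP => m; rewrite mcoeff0; apply: (mulfI (mfact_neq0 m)).
by rewrite mcoeff_apolar h mulr0.
Qed.

End ApolarPairing.

(** * Schemes defined by linear functionals *)

Section MinLength.
Variable R : realType.

Lemma minlength_le (A : set nat) r : A r -> (minlength R A <= r%:R%:E)%E.
Proof. by move=> Ar; apply: ereal_inf_lbound; exists r. Qed.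

Lemma minlength_attained (A : set nat) r : minlength R A = r%:R%:E -> A r.
Proof.
move=> h; have [s As] : exists s, A s.
  apply: contrapT => nA; move: h; rewrite /minlength.
  suff -> : ([set r0%:R%:E | r0 in A] = set0 :> set (\bar R))%classic.
    by rewrite ereal_inf0.
  by apply/seteqP; split => // x [s As]; case: nA; exists s.
have exA : exists s, `[< A s >] by exists s; apply/asboolP.
case: (ex_minnP exA) => s0 /asboolP As0 smin.
suff : minlength R A = s0%:R%:E.
  by rewrite h => -[/eqP]; rewrite eqr_nat => /eqP ->.
apply/eqP; rewrite eq_le minlength_le //=.
apply: le_ereal_inf_tmp => _ [s1 As1 <-].
by rewrite lee_fin ler_nat; apply: smin; apply/asboolP.
Qed.

End MinLength.

Section SchemeOfFunctionals.
Variables (R : realType) (N k : nat) (b : 'I_N -> 'I_k).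
Local Notation C := R[i].
Local Notation poly := {mpoly C[N]}.
Implicit Types (p q : poly) (m : 'X_{1..N}) (u : 'I_k -> nat).

Variables (M : nat) (phi : 'X_{1..N} -> 'rV[C]_M) (a : 'I_N -> C).
Local Notation Phi := (mlift phi).

(* The common kernel of the functionals is an ideal, and in every block there is
   a linear form that is congruent to 1 modulo it: the affine chart in which
   the scheme lives. *)
Hypothesis kerX : forall v p, Phi p = 0 -> Phi ('X_v * p) = 0.
Hypothesis unitL : forall i p,
  Phi ((\sum_(v | b v == i) a v *: 'X_v) * p) = Phi p.

(** The largest multihomogeneous ideal inside the kernel of the functionals:
the homogenization of this kernel by means of the chart forms. *)
Definition homogeneous_kernel : set poly :=
  [set p | forall u, Phi (component b u p) = 0].

Local Notation J := homogeneous_kernel.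

Lemma kerXM m p : Phi p = 0 -> Phi ('X_[m] * p) = 0.
Proof.
move=> hp; rewrite mpolyXE_id; elim/big_rec: _ => [|v q _ hq].
  by rewrite mul1r.
rewrite -mulrA; elim: (m v) => [|e IHe]; first by rewrite expr0 mul1r.
by rewrite exprS -mulrA kerX.
Qed.

Lemma homogeneous_kernelP u p : multihomog b u p -> J p <-> Phi p = 0.
Proof.
move=> hp; split=> [/(_ u)|p0 u']; first by rewrite component_id.
have [h|nh] := pselect (forall i, u' i = u i).
  by rewrite component_id // => m /hp + i; rewrite h.
suff -> : component b u' p = 0 by rewrite mlift0.
apply/mpolyP => m; rewrite mcoeff_component mcoeff0.
case: has_degP => // hm; apply/memN_msupp_eq0/negP => /hp hu.
by apply: nh => i; rewrite -hm hu.
Qed.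

Lemma homogeneous_kernelD p q : J p -> J q -> J (p + q).
Proof. by move=> hp hq u; rewrite /component !mliftD hp hq addr0. Qed.

Lemma homogeneous_kernelM h p : J p -> J (h * p).
Proof.
move=> hp; rewrite [h]mpolyE mulr_suml.
elim/big_rec: _ => [u|m q _ Jq]; first by rewrite /component !mlift0.
refine (homogeneous_kernelD _ Jq) => u.
rewrite -scalerAl /component !mliftZ -/(component b u _).
have [le_mu|nle] := pselect (forall i, block_deg b m i <= u i)%N.
  by rewrite componentXM // kerXM ?scaler0.
by rewrite componentXM0 // mlift0 scaler0.
Qed.

Lemma homogeneous_kernel_multihomog : multihomog_ideal b J.
Proof.
exists [set g | J g /\ exists u, multihomog b u g]%classic.
split=> [g [_ //]|]; apply/seteqP; split=> p.
  move=> Jp; have [r [u pE]] := sum_components b p.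
  exists r, (fun=> 1), (fun s => component b (u s) p); split.
    move=> s; split; last by exists (u s); apply: component_multihomog.
    by apply/(homogeneous_kernelP (@component_multihomog _ _ _ b (u s) p)).
  by under eq_bigr do rewrite mul1r.
case=> r [h [g [hg ->]]]; elim/big_rec: _ => [u|s x _ Jx].
  by rewrite /component !mlift0.
by refine (homogeneous_kernelD (homogeneous_kernelM _ _) Jx); case: (hg s).
Qed.

(** Multiplying by the product of the chart forms, one for each block, does not
change the functionals, and this product is a combination of products of
variables, one from each block. *)
Lemma homogeneous_kernel_saturated : saturated b J.
Proof.
move=> p hp u.
have -> : Phi (component b u p) =
    Phi ((\prod_(i < k) \sum_(v | b v == i) a v *: 'X_v) * component b u p).
  elim/big_rec: _ => [|i x _ ->]; first by rewrite mul1r.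
  by rewrite -mulrA unitL.
rewrite (bigA_distr_big_dep (fun i v => b v == i) (fun i v => a v *: 'X_v)).
rewrite mulr_suml mlift_sum big1 // => v /familyP fv.
have bv i : b (v i) = i by apply/eqP; apply: fv.
rewrite scaler_prod -scalerAl mliftZ.
have -> : \prod_(i < k) 'X_(v i) = 'X_[\sum_(i < k) U_(v i)] :> poly.
  by rewrite mprodXE.
have hdeg i : block_deg b (\sum_(i < k) U_(v i)) i = 1%N.
  rewrite (big_morph (fun m => block_deg b m i) (id1 := 0%N) (op1 := addn)) /=;
    last first.
  - by rewrite /block_deg big1 // => j _; rewrite mnm0E.
  - by move=> x y; rewrite block_degD.
  rewrite (bigD1 i) //= block_degU bv eqxx big1 // => j /negbTE.
  by rewrite block_degU bv => ->.
have /(_ (fun i => (u i).+1)) := hp v bv.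
rewrite mprodXE componentXM => [|i]; last by rewrite hdeg.
rewrite (_ : (fun i => _) = u); last by apply/funext => i; rewrite hdeg subn1.
by move=> ->; rewrite scaler0.
Qed.

Lemma multihomog_linear_closed u : linear_closed (multihomog b u : set poly).
Proof.
move=> s c e p hp he; rewrite addrC -scaleN1r.
by apply: multihomog_linear => //; exact: multihomog_sum.
Qed.

(** The value s of the Hilbert function in degree u, as the dimension of the
image of the forms of degree u. *)
Definition image_dim u s := exists e : 'I_s -> poly,
  [/\ forall i, multihomog b u (e i), row_free (\matrix_i Phi (e i)) &
      forall p, multihomog b u p -> (Phi p <= \matrix_i Phi (e i))%MS].

(** Multiplication by powers of the chart forms raises the degree without
changing the values of the functionals, so the images grow with u. *)
Lemma image_dim_mono u u' s s' : (forall i, u i <= u' i)%N ->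
  image_dim u s -> image_dim u' s' -> (s <= s')%N.
Proof.
move=> uu' [e [he /eqP rk _]] [e' [_ /eqP rk' span']].
rewrite -rk -rk'; apply: mxrankS; apply/row_subP => i; rewrite rowK.
pose L i : poly := \sum_(v | b v == i) a v *: 'X_v.
have hL j u1 p : multihomog b u1 p ->
    multihomog b (fun i => (i == j) + u1 i)%N (L j * p).
  move=> hp; rewrite mulr_suml => m /msupp_sum_le /flattenP [/= l].
  case/mapP => v; rewrite mem_filter => /andP [/eqP bv _] -> {l}.
  rewrite -scalerAl => /msuppZ_le /(multihomogXM hp) h i1.
  by rewrite h block_degU bv eq_sym.
have hLn n j u1 p : multihomog b u1 p ->
    multihomog b (fun i => (i == j) * n + u1 i)%N (L j ^+ n * p)
    /\ Phi (L j ^+ n * p) = Phi p.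
  move=> hp; elim: n => [|n [IH1 IH2]].
    by rewrite expr0 mul1r; split=> // m /hp h i1; rewrite muln0 h.
  rewrite exprS -mulrA unitL; split=> // m /(hL j _ _ IH1) h i1.
  by rewrite h mulnS addnA.
suff [q hq <-] : exists2 q, multihomog b u' q & Phi q = Phi (e i).
  exact: span'.
have : forall (r : seq 'I_k), uniq r -> exists2 q,
   multihomog b (fun j => if j \in r then u' j else u j) q & Phi q = Phi (e i).
  elim=> [|j r IHr] /=; first by exists (e i).
  case/andP => jr /IHr [q hq <-].
  have [h1 h2] := hLn (u' j - u j)%N j _ _ hq.
  exists (L j ^+ (u' j - u j) * q) => // m /h1 h i1; rewrite h inE.
  case: eqVneq => [->|_] /=; last by rewrite mul0n.
  by rewrite (negbTE jr) mul1n subnK.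
case/(_ (enum 'I_k) (enum_uniq _)) => q hq <-; exists q => // m /hq h j.
by rewrite h mem_enum.
Qed.

(** The Hilbert function is monotone and bounded by the number M of functionals,
hence constant beyond any degree where it reaches its maximum. *)
Lemma zero_dim_scheme_of_functionals :
  exists2 r, (r <= M)%N & zero_dim_scheme b r J.
Proof.
have exd u : exists s, image_dim u s.
  have [s [e [h1 h2 h3]]] := free_spanning_family (multihomog b u) Phi.
  by exists s, e.
pose Q s := `[< exists u, image_dim u s >].
have exQ : exists s, Q s.
  have [s hs] := exd (fun=> 0%N).
  by exists s; apply/asboolP; exists (fun=> 0%N).
have Qle s : Q s -> (s <= M)%N.
  by move=> /asboolP [u [e [_ /eqP rk _]]]; rewrite -rk; apply: rank_leq_col.
case: (ex_maxnP exQ Qle) => s Qs smax; exists s; first exact: Qle.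
split.
- exact: homogeneous_kernel_multihomog.
- exact: homogeneous_kernel_saturated.
have /asboolP [u0 hu0] := Qs; exists u0 => u le_u0u.
have [s' hs'] := exd u.
have ss' : s' = s.
  apply/eqP; rewrite eqn_leq (image_dim_mono le_u0u hu0 hs') andbT.
  by apply: smax; apply/asboolP; exists u.
rewrite -ss'; case: hs' => e [h1 h2 h3].
apply: (quotient_dim_free _ _ h1 h2 h3); first exact: multihomog_linear_closed.
by move=> p /homogeneous_kernelP.
Qed.

(** When the functionals compute the pairing with t in degree d, the scheme that
they define has t in its span. *)
Lemma cactus_rank_of_functionals (d : 'I_k -> nat) (t : poly) (psi : 'cV[C]_M) :
  multihomog b d t ->
  (forall m, has_deg b d m -> divpow_coef t m = (phi m *m psi) 0 0) ->
  (cactus_rank b d t <= M%:R%:E)%E.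
Proof.
move=> ht hpsi; have [r le_rM hJ] := zero_dim_scheme_of_functionals.
apply: (@le_trans _ _ (r%:R%:E : \bar R)); last by rewrite lee_fin ler_nat.
apply: minlength_le; exists J; split=> // D JD hD; apply/apolar_idealP => m.
have {}JD : Phi D = 0 by apply/(homogeneous_kernelP hD).
have [-> {m}|m0] := eqVneq m 0%MM.
  transitivity ((Phi D *m psi) 0 0); last by rewrite JD mul0mx mxE.
  rewrite /mlift mulmx_suml summxE; apply: eq_big_seq => m mD.
  rewrite addm0 hpsi; last by apply/has_degP; apply: hD.
  by rewrite -scalemxAl [RHS]mxE.
rewrite /mlift big_seq big1 // => m' m'D; rewrite /divpow_coef.
rewrite (memN_msupp_eq0 (m := (m' + m)%MM)) ?mulr0 ?scaler0 //.
apply/negP => /ht h; case/negP: m0; rewrite -mdeg_eq0 (mdeg_block_deg b).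
rewrite sum_nat_eq0; apply/forallP => i; apply/implyP => _.
by have := h i; rewrite block_degD (hD _ m'D); lia.
Qed.

End SchemeOfFunctionals.

(** * Coordinates on a zero-dimensional scheme in projective space *)

Section IdealSpan.
Variables (R : realType) (N : nat).
Local Notation C := R[i].
Local Notation poly := {mpoly C[N]}.
Implicit Types (G : set poly) (p q : poly).

Lemma ideal_span0 G : ideal_span G 0.
Proof.
have f0 : 'I_0 -> poly by case.
by exists 0%N, f0, f0; split; [case|rewrite big_ord0].
Qed.

Lemma ideal_spanD G p q :
  ideal_span G p -> ideal_span G q -> ideal_span G (p + q).
Proof.
move=> [r1 [h1 [g1 [Gg1 ->]]]] [r2 [h2 [g2 [Gg2 ->]]]].
pose cat (f1 : 'I_r1 -> poly) (f2 : 'I_r2 -> poly) (i : 'I_(r1 + r2)) :=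
  match fintype.split i with inl j => f1 j | inr j => f2 j end.
exists (r1 + r2)%N, (cat h1 h2), (cat g1 g2); split.
  by move=> i; rewrite /cat; case: (fintype.split i).
have catl f1 f2 i : cat f1 f2 (lshift r2 i) = f1 i.
  by rewrite /cat -[lshift _ _]/(unsplit (inl i)) unsplitK.
have catr f1 f2 i : cat f1 f2 (rshift r1 i) = f2 i.
  by rewrite /cat -[rshift _ _]/(unsplit (inr i)) unsplitK.
by rewrite big_split_ord; congr (_ + _); apply: eq_bigr => i _;
  rewrite ?catl ?catr.
Qed.

Lemma ideal_spanM G h p : ideal_span G p -> ideal_span G (h * p).
Proof.
move=> [r [h1 [g [Gg ->]]]]; exists r, (fun s => h * h1 s), g; split=> //.
by rewrite mulr_sumr; apply: eq_bigr => s _; rewrite mulrA.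
Qed.

End IdealSpan.

Section OneBlock.
Variables (R : realType) (N : nat).
Local Notation C := R[i].
Local Notation poly := {mpoly C[N]}.

Lemma one_block_deg (m : 'X_{1..N}) i : block_deg (@one_block N) m i = mdeg m.
Proof.
by rewrite (ord1 i) mdegE /block_deg; apply: eq_bigl => j; rewrite eqxx.
Qed.

Lemma dhomog_mpolyX u (m : 'X_{1..N}) :
  mdeg m = u -> ('X_[m] : poly) \is u.-homog.
Proof. by move=> <-; rewrite dhomogX. Qed.

Lemma one_block_homogP (u : 'I_1 -> nat) (p : poly) :
  reflect (multihomog (@one_block N) u p) (p \is (u ord0).-homog).
Proof.
apply: (iffP (dhomogP _ _ _)) => [h m mp i|h m /h /(_ ord0)].
  by rewrite one_block_deg ord1 -(h m mp).
by rewrite one_block_deg.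
Qed.

End OneBlock.

Section ZeroDimIdeal.
Variables (R : realType) (N : nat).
Local Notation C := R[i].
Local Notation poly := {mpoly C[N]}.
Implicit Types (p q : poly) (m : 'X_{1..N}).

Variable I : set poly.
Hypothesis I0 : I 0.
Hypothesis ID : forall p q, I p -> I q -> I (p + q).
Hypothesis IM : forall h p, I p -> I (h * p).
Hypothesis Isat : forall p, (forall v, I ('X_v * p)) -> I p.

Lemma idealZ c p : I p -> I (c *: p).
Proof. by rewrite -mul_mpolyC; apply: IM. Qed.

Lemma idealN p : I p -> I (- p).
Proof. by rewrite -scaleN1r; apply: idealZ. Qed.

Lemma idealB p q : I p -> I q -> I (p - q).
Proof. by move=> Ip /idealN; apply: ID. Qed.

Lemma ideal_sum (T : eqType) (s : seq T) (P : pred T) (f : T -> poly) :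
  (forall i, i \in s -> P i -> I (f i)) -> I (\sum_(i <- s | P i) f i).
Proof.
move=> h; rewrite big_seq_cond; elim/big_rec: _ => // i x /andP[si Pi].
by apply: ID; apply: h.
Qed.

Lemma ideal_trans p q1 q2 : I (p - q1) -> I (q1 - q2) -> I (p - q2).
Proof. by move=> h1 h2; have := ID h1 h2; rewrite addrA subrK. Qed.

Lemma saturated_deg u p : (forall m, mdeg m = u -> I ('X_[m] * p)) -> I p.
Proof.
elim: u p => [|u IHu] p h.
  by have := h 0%MM (@mdeg0 N); rewrite mpolyX0 mul1r.
apply: IHu => m mu; apply: Isat => v; rewrite mulrA -mpolyXD; apply: h.
by rewrite mdegD mdeg1 mu.
Qed.

(** McCoy's theorem for the polynomial l_t = sum_v t^v x_v over the ring modulo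
a saturated ideal I: if l_t * sum_i t^i p_i has all its coefficients in I, then
so has sum_i t^i p_i.  Considering the variables from the last one downwards,
the top coefficient of the relation shows that x_v p_D lies in I, so the family
x_v p_i satisfies the same relation with fewer terms. *)
Lemma mccoy D (p : nat -> poly) :
  (forall i, (D <= i)%N -> I (p i)) ->
  (forall i, I (\sum_(v < N | (v <= i)%N) 'X_v * p (i - v)%N)) ->
  forall i, I (p i).
Proof.
elim: D p => [|D IHD] p pD prel i; first exact: pD.
suff Xp j : (j <= N)%N -> forall (v : 'I_N), (N - j <= v)%N ->
    forall i, I ('X_v * p i).
  by apply: Isat => v; apply: (Xp N) => //; rewrite subnn.
elim: j => [|j IHj] jN v; first by rewrite subn0 leqNgt ltn_ord.
move=> le_v {}i; have [lt_v|v_le] := ltnP (N - j.+1) v.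
  by apply: IHj; lia.
have wIH (w : 'I_N) i' : (v < w)%N -> I ('X_w * p i').
  by move=> vw; apply: IHj; lia.
move: i; apply: (IHD (fun i => 'X_v * p i)) => [i|i]; last first.
  have -> : \sum_(w < N | (w <= i)%N) 'X_w * ('X_v * p (i - w)%N) =
      'X_v * \sum_(w < N | (w <= i)%N) 'X_w * p (i - w)%N.
    by rewrite mulr_sumr; apply: eq_bigr => w _; rewrite mulrCA.
  exact: IM.
rewrite leq_eqVlt => /predU1P [<-|lt_Di]; last by apply/IM/pD.
have := prel (D + v)%N; rewrite (bigD1 v) ?leq_addl //= addnK => h.
set S := (X in I (_ + X)) in h.
suff IS : I S by have := idealB h IS; rewrite addrK.
apply: ideal_sum => w _ /andP[wD wv]; have [/wIH //|] := ltnP v w.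
rewrite leq_eqVlt (_ : (w == v :> nat) = false) => [/= lt_wv|];
  last exact/negbTE.
by apply/IM/pD; lia.
Qed.

Section Chart.
Variable r : nat.

Definition lincomb (e : 'I_r -> poly) (c : 'rV[C]_r) : poly :=
  \sum_s c 0 s *: e s.

Lemma lincombD e c1 c2 : lincomb e (c1 + c2) = lincomb e c1 + lincomb e c2.
Proof. by rewrite -big_split; apply: eq_bigr => s _; rewrite mxE scalerDl. Qed.

Lemma lincombZ e x c : lincomb e (x *: c) = x *: lincomb e c.
Proof. by rewrite scaler_sumr; apply: eq_bigr => s _; rewrite mxE scalerA. Qed.

Lemma lincomb0 e : lincomb e 0 = 0.
Proof. by rewrite /lincomb big1 // => s _; rewrite mxE scale0r. Qed.

Lemma lincomb_sum e (T : Type) (l : seq T) (P : pred T) (f : T -> 'rV[C]_r) :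
  lincomb e (\sum_(i <- l | P i) f i) = \sum_(i <- l | P i) lincomb e (f i).
Proof.
elim/big_rec2: _ => [|i x y _ <-]; first exact: lincomb0.
by rewrite lincombD.
Qed.

Lemma lincomb_mulmx (x : poly) (e f : 'I_r -> poly) (A : 'M[C]_r) c :
  (forall s, I (f s - x * lincomb e (row s A))) ->
  I (lincomb f c - x * lincomb e (c *m A)).
Proof.
move=> h; rewrite mulmx_sum_row lincomb_sum mulr_sumr -sumrB.
apply: ideal_sum => s _ _; rewrite lincombZ -scalerAr -scalerBr; exact: idealZ.
Qed.

Lemma quotient_dimP (U : set poly) : U 0 -> quotient_dim U I r ->
  exists e : 'I_r -> poly, [/\ forall s, U (e s),
    forall p, U p -> exists c, I (p - lincomb e c) &
    forall c, I (lincomb e c) -> c = 0].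
Proof.
move=> U0 [e [Ue he]]; exists e; split=> // [p /he [c [hc _]]|c hc].
  by exists c.
have [c0 [h0 uniq]] := he 0 U0.
rewrite -(uniq 0) ?(uniq c) //; first by rewrite sub0r; apply: idealN.
by have := lincomb0 e; rewrite /lincomb => ->; rewrite subr0.
Qed.

Variable u0 : nat.
Hypothesis dimI : forall u, (u0 <= u)%N ->
  quotient_dim (fun p => p \is u.-homog) I r.

Definition curve_form (t : C) : poly := \sum_(v < N) t ^+ v *: 'X_v.

(** In terms of bases e and e' in the degrees u0 and u0 + 1, the variables act
by matrices B_v, and l_t by sum_v t^v B_v.  A kernel vector of the latter over
the polynomials in t contradicts McCoy's theorem, so its determinant P is
nonzero.  Where P(t) is nonzero, the matrices A_v describe the action of x_v / l_t. *)
Lemma exists_chart : exists2 P : {poly C}, P != 0 & forall t, P.[t] != 0 ->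
  exists (e : 'I_r -> poly) (A : 'I_N -> 'M[C]_r),
  [/\ forall s, e s \is u0.-homog,
      forall p, p \is u0.-homog -> exists c, I (p - lincomb e c),
      \sum_(v < N) t ^+ v *: A v = 1%:M &
      forall v s, I ('X_v * e s - curve_form t * lincomb e (row s (A v)))].
Proof.
have [e [e_hom e_span e_free]] :=
  quotient_dimP (dhomog0 _ _ _) (dimI (leqnn u0)).
have [e' [e'_hom e'_span e'_free]] :=
  quotient_dimP (dhomog0 _ _ _) (dimI (leqnSn u0)).
have hX v s : 'X_v * e s \is u0.+1.-homog.
  by rewrite -add1n; apply: dhomogM => //; exact/dhomog_mpolyX/mdeg1.
have [B hB] : exists B : 'I_N -> 'M[C]_r,
    forall v s, I ('X_v * e s - lincomb e' (row s (B v))).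
  have /choice [B hB] : forall vs : 'I_N * 'I_r, exists c,
      I ('X_(vs.1) * e vs.2 - lincomb e' c) by move=> [v s]; apply: e'_span.
  exists (fun v => \matrix_s B (v, s)) => v s.
  by rewrite rowK; apply: (hB (v, s)).
pose Bt : 'M[{poly C}]_r := \sum_(v < N) 'X^v *: map_mx polyC (B v).
exists (\det Bt).
  apply/negP => /det0P [w w_neq0 wB]; case/negP: w_neq0; apply/eqP.
  pose wi i : 'rV[C]_r := \row_s (w 0 s)`_i.
  suff wi0 i : wi i = 0.
    apply/rowP => s; apply/polyP => i; rewrite mxE coef0.
    by have /rowP/(_ s) := wi0 i; rewrite !mxE.
  apply: e_free; move: i.
  pose D := (\max_(s < r) size (w 0%R s))%N.
  apply: (@mccoy D) => [i le_Di|i].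
    suff -> : wi i = 0 by rewrite lincomb0.
    apply/rowP => s; rewrite !mxE nth_default //.
    exact: leq_trans (leq_bigmax _) le_Di.
  have cE v (q : {poly C}) (x : C) :
      (q * ('X^v * x%:P))`_i = if (i < v)%N then 0 else q`_(i - v) * x.
    by rewrite mulrCA mulrC coefMXn coefMC.
  have wB0 : \sum_(v < N | (v <= i)%N) wi (i - v)%N *m B v = 0.
    apply/rowP => s'; rewrite summxE [RHS]mxE.
    transitivity (((w *m Bt) 0 s')`_i); last by rewrite wB mxE coef0.
    rewrite /Bt mulmx_sumr summxE coef_sum big_mkcond /=.
    apply: eq_bigr => v _; rewrite !mxE coef_sum.
    case: leqP => vi.
      by apply: eq_bigr => s _; rewrite !mxE cE ltnNge vi.
    by rewrite [RHS]big1 // => s _; rewrite !mxE cE vi.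
  have -> : \sum_(v < N | (v <= i)%N) 'X_v * lincomb e (wi (i - v)%N) =
    \sum_(v < N | (v <= i)%N) ('X_v * lincomb e (wi (i - v)%N)
       - lincomb e' (wi (i - v)%N *m B v)).
    by rewrite sumrB -lincomb_sum wB0 lincomb0 subr0.
  apply: ideal_sum => v _ _; rewrite -[lincomb e' _]mul1r.
  rewrite (_ : 'X_v * _ = lincomb (fun s => 'X_v * e s) (wi (i - v)%N)).
    by apply: lincomb_mulmx => s; rewrite mul1r; exact: hB.
  by rewrite mulr_sumr; apply: eq_bigr => s _; rewrite scalerAr.
move=> t; set P := (_.[t]); move=> Pt.
pose Bn : 'M[C]_r := \sum_(v < N) t ^+ v *: B v.
have Bn_unit : Bn \in unitmx.
  rewrite unitmxE unitfE; suff -> : \det Bn = P by [].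
  rewrite /P -[RHS]/(horner_eval t _) -det_map_mx; congr (\det _).
  apply/matrixP => s s'; rewrite !mxE summxE /Bt summxE /horner_eval.
  rewrite -[RHS]/(_.[t]) horner_sum; apply: eq_bigr => v _.
  by rewrite !mxE hornerM hornerXn hornerC.
exists e, (fun v => B v *m invmx Bn); split=> //.
  under eq_bigr do rewrite scalemxAl.
  by rewrite -mulmx_suml mulmxV.
move=> v s; apply: ideal_trans (hB v s) _.
rewrite -opprB; apply: idealN; rewrite row_mul.
have le s' : I (curve_form t * e s' - 1 * lincomb e' (row s' Bn)).
  have -> : row s' Bn = \sum_(w < N) t ^+ w *: row s' (B w).
    apply/rowP => j; rewrite mxE !summxE.
    by apply: eq_bigr => w _; rewrite !mxE.
  rewrite mul1r /curve_form mulr_suml lincomb_sum -sumrB.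
  apply: ideal_sum => w _ _; rewrite lincombZ -scalerAl -scalerBr.
  exact/idealZ/hB.
have := lincomb_mulmx (row s (B v) *m invmx Bn) le.
rewrite mulmxKV // mul1r; congr (I (_ - _)).
by rewrite mulr_sumr; apply: eq_bigr => s' _; rewrite scalerAr.
Qed.

Section CoordinatesInChart.
Variables (t : C) (e : 'I_r -> poly) (A : 'I_N -> 'M[C]_r).
Hypothesis e_hom : forall s, e s \is u0.-homog.
Hypothesis e_span : forall p, p \is u0.-homog -> exists c, I (p - lincomb e c).
Hypothesis A_mul : forall v s,
  I ('X_v * e s - curve_form t * lincomb e (row s (A v))).
Local Notation ell := (curve_form t).

Lemma curve_form_homog : ell \is 1.-homog.
Proof.
apply: rpred_sum => v _; apply: rpredZ; exact/dhomog_mpolyX/mdeg1.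
Qed.

Lemma curve_powM_homog j u p :
  p \is u.-homog -> ell ^+ j * p \is (u + j).-homog.
Proof.
move=> hp; rewrite addnC; apply: dhomogM => //.
by have := dhomogMn j curve_form_homog; rewrite mul1n.
Qed.

Lemma chart_mulX v j c :
  I ('X_v * (ell ^+ j * lincomb e c) - ell ^+ j.+1 * lincomb e (c *m A v)).
Proof.
rewrite mulrCA exprSr -mulrA -mulrBr; apply: IM.
have -> : 'X_v * lincomb e c = lincomb (fun s => 'X_v * e s) c.
  by rewrite mulr_sumr; apply: eq_bigr => s _; rewrite scalerAr.
by apply: lincomb_mulmx => s; apply: A_mul.
Qed.

Lemma chart_spanX j m : mdeg m = (u0 + j)%N ->
  exists c, I ('X_[m] - ell ^+ j * lincomb e c).
Proof.
elim: j m => [|j IHj] m dm.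
  have [|c hc] := e_span (p := 'X_[m]).
    by apply: dhomog_mpolyX; rewrite dm addn0.
  by exists c; rewrite expr0 mul1r.
have [v mv] : exists v, m v != 0%N.
  apply: contrapT => nv; have : mdeg m == 0%N; last by rewrite dm addnS.
  rewrite mdegE sum_nat_eq0; apply/forallP => v; apply/implyP => _.
  by apply/negPn/negP => mv; apply: nv; exists v.
have mE : m = (U_(v) + (m - U_(v)))%MM by rewrite addmC submK // lep1mP.
have dm' : mdeg (m - U_(v)) = (u0 + j)%N.
  by apply: (@addnI 1%N); rewrite -[in LHS](mdeg1 v) -mdegD -mE dm addnS.
have [c hc] := IHj _ dm'; exists (c *m A v).
apply: ideal_trans (chart_mulX v j c).
by rewrite {1}mE mpolyXD -mulrBr; apply: IM.
Qed.

Lemma chart_span j p : p \is (u0 + j).-homog ->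
  exists c, I (p - ell ^+ j * lincomb e c).
Proof.
move=> /dhomogP hp.
have /choice [c hc] : forall m, exists c : 'rV[C]_r,
    mdeg m = (u0 + j)%N -> I ('X_[m] - ell ^+ j * lincomb e c).
  move=> m; have [/chart_spanX [c hc]|ne] := eqVneq (mdeg m) (u0 + j)%N.
    by exists c.
  by exists 0 => /eqP; rewrite (negbTE ne).
exists (\sum_(m <- msupp p) p@_m *: c m).
rewrite {1}[p]mpolyE lincomb_sum mulr_sumr -sumrB; apply: ideal_sum => m mp _.
by rewrite lincombZ -scalerAr -scalerBr; apply/idealZ/hc/hp.
Qed.

(** The elements l^j e_s, of which there are r, span the quotient in degree
u0 + j, which has dimension r; hence they are independent there. *)
Lemma chart_free j c : I (ell ^+ j * lincomb e c) -> c = 0.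
Proof.
move=> hc.
have [f [f_hom f_span f_free]] :=
  quotient_dimP (dhomog0 _ _ _) (dimI (leq_addr j u0)).
have /choice [P hP] : forall i, exists c, I (f i - ell ^+ j * lincomb e c).
  by move=> i; apply: chart_span.
have /choice [Q hQ] : forall s, exists c, I (ell ^+ j * e s - lincomb f c).
  by move=> s; apply: f_span; apply: curve_powM_homog.
(* P and Q are inverse changes of basis. *)
pose PM := \matrix_i P i; pose QM := \matrix_s Q s.
have toQ c' : I (ell ^+ j * lincomb e c' - lincomb f (c' *m QM)).
  rewrite -[lincomb f _]mul1r.
  rewrite (_ : _ * lincomb e c' = lincomb (fun s => ell ^+ j * e s) c').
    by apply: lincomb_mulmx => s; rewrite rowK mul1r; apply: hQ.
  by rewrite mulr_sumr; apply: eq_bigr => s _; rewrite scalerAr.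
have PQ : PM *m QM = 1%:M.
  apply/row_matrixP => i; apply/eqP; rewrite eq_sym -subr_eq0; apply/eqP.
  apply: f_free; rewrite lincombD -[- row i _]scaleN1r lincombZ scaleN1r.
  rewrite (_ : lincomb f (row i 1%:M) = f i).
    by apply: ideal_trans (hP i) _; rewrite row_mul rowK; apply: toQ.
  rewrite /lincomb (bigD1 i) //= big1 ?addr0 => [|s /negbTE si].
    by rewrite !mxE eqxx scale1r.
  by rewrite !mxE eq_sym si scale0r.
have cQ : c *m QM = 0.
  by apply: f_free; have := idealB hc (toQ c); rewrite opprB addrC subrK.
by rewrite -[c]mulmx1 -(mulmx1C PQ) mulmxA cQ mul0mx.
Qed.

(** In degrees at least u0 the form l is a nonzerodivisor by chart_free;
saturation brings a form of lower degree into this range. *)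
Lemma chart_curve_reg j u p : p \is u.-homog -> I (ell ^+ j * p) -> I p.
Proof.
move=> hp hjp; apply: (@saturated_deg u0) => m dm.
have [|c hc] := @chart_span u ('X_[m] * p).
  by apply: dhomogM => //; apply: dhomog_mpolyX.
suff c0 : c = 0 by rewrite c0 lincomb0 mulr0 subr0 in hc.
apply: (@chart_free (j + u)); rewrite exprD -mulrA.
have h1 : I (ell ^+ j * ('X_[m] * p)) by rewrite mulrCA; apply: IM.
have := idealB h1 (IM (ell ^+ j) hc).
by rewrite mulrBr opprB addrC subrK.
Qed.

(** E m consists of the coordinates of l^u0 X^m in the basis l^(deg m) e_s: up
to powers of l, the monomial m as an element of the algebra of functions. *)
Lemma exists_coordinates :
  exists E : 'X_{1..N} -> 'rV[C]_r,
  (forall v m, E (U_(v) + m)%MM = E m *m A v) /\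
  forall u p, p \is u.-homog -> mlift E p = 0 -> I p.
Proof.
have /choice [E hE] : forall m, exists c,
    I (ell ^+ u0 * 'X_[m] - ell ^+ mdeg m * lincomb e c).
  move=> m; apply: chart_span; rewrite addnC; apply: curve_powM_homog.
  exact: dhomog_mpolyX.
exists E; split=> [v m|u p hp Ep].
  apply/eqP; rewrite -subr_eq0; apply/eqP; apply: (@chart_free (mdeg m).+1).
  rewrite lincombD -[- (E m *m _)]scaleN1r lincombZ scaleN1r mulrBr.
  have h1 := hE (U_(v) + m)%MM; have h2 := IM 'X_v (hE m).
  have h3 := chart_mulX v (mdeg m) (E m).
  rewrite mdegD mdeg1 add1n mpolyXD in h1.
  have := ID (ID (idealN h1) h2) h3; congr (I _).
  ring.
apply: (@chart_curve_reg u0 u p hp).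
have -> : ell ^+ u0 * p = \sum_(m <- msupp p)
    p@_m *: (ell ^+ u0 * 'X_[m] - ell ^+ mdeg m * lincomb e (E m)).
  rewrite {1}[p]mpolyE mulr_sumr; apply/eqP; rewrite -subr_eq0 -sumrB.
  rewrite (_ : \sum_(m <- msupp p) _ =
    \sum_(m <- msupp p) ell ^+ u * lincomb e (p@_m *: E m)).
    by rewrite -mulr_sumr -lincomb_sum -/(mlift E p) Ep lincomb0 mulr0.
  apply: eq_big_seq => m /(dhomog_mf hp) /= dm.
  by rewrite -scalerAr -scalerBr opprB addrC subrK lincombZ dm scalerAr.
by apply: ideal_sum => m _ _; apply/idealZ/hE.
Qed.

End CoordinatesInChart.
End Chart.
End ZeroDimIdeal.

Section SchemeCoordinates.
Variables (R : realType) (N : nat).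
Local Notation C := R[i].
Local Notation poly := {mpoly C[N]}.

(** The pairing with g vanishes on the degree d part of the ideal, which
contains the kernel of the coordinates, so it factors through them. *)
Lemma exists_scheme_coordinates r (I : set poly) d (g : poly) :
  zero_dim_scheme (@one_block N) r I ->
  in_scheme_span (@one_block N) (fun=> d) I g ->
  exists2 P : {poly C}, P != 0 & forall t, P.[t] != 0 ->
  exists (E : 'X_{1..N} -> 'rV[C]_r) (A : 'I_N -> 'M[C]_r) (psi : 'cV[C]_r),
  [/\ forall v m, E (U_(v) + m)%MM = E m *m A v,
      \sum_(v < N) t ^+ v *: A v = 1%:M &
      forall m, mdeg m = d -> divpow_coef g m = (E m *m psi) 0 0].
Proof.
move=> [[G [_ IE]] Isat [u0 Idim]] Ig.
have I0 : I 0 by rewrite IE; apply: ideal_span0.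
have ID p q : I p -> I q -> I (p + q) by rewrite IE; apply: ideal_spanD.
have IM h p : I p -> I (h * p) by rewrite IE; apply: ideal_spanM.
have Isat1 p : (forall v, I ('X_v * p)) -> I p.
  by move=> h; apply: Isat => v _; rewrite big_ord1; apply: h.
have Idim1 u : (u0 ord0 <= u)%N ->
    quotient_dim (fun p : poly => p \is u.-homog) I r.
  move=> le_u; have -> : (fun p : poly => p \is u.-homog : Prop) =
      multihomog (@one_block N) (fun=> u).
    apply/funext => p; apply/propext.
    by split=> /(one_block_homogP (fun=> u) p).
  by apply: Idim => i; rewrite ord1.
have [P P0 chart] := exists_chart I0 ID IM Isat1 Idim1.
exists P => // t /chart [e [A [e_hom e_span A_unit A_mul]]].
have [E [E_mul E_ker]] :=
  exists_coordinates I0 ID IM Isat1 Idim1 e_hom e_span A_mul.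
have [|psi hpsi] := @factor_through _ r 'X_{1..N < d.+1}
  (fun m : 'X_{1..N < d.+1} => if mdeg m == d then E m else 0)
  (fun m : 'X_{1..N < d.+1} => if mdeg m == d then divpow_coef g m else 0).
  move=> c c0.
  pose D : poly := \sum_(i : 'X_{1..N < d.+1} | mdeg i == d) c i *: 'X_[i].
  have D_hom : D \is d.-homog.
    by apply: rpred_sum => i /eqP di; apply/rpredZ/dhomog_mpolyX.
  have liftD (V : lmodType C) (v : 'X_{1..N} -> V) :
      mlift v D =
      \sum_(i : 'X_{1..N < d.+1}) c i *: (if mdeg i == d then v i else 0).
    rewrite mlift_sum big_mkcond /=; apply: eq_bigr => i _.
    by case: ifP; rewrite ?scaler0 // mliftZ mliftX.
  have ID0 : I D by apply: (E_ker d D D_hom); rewrite liftD.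
  have /apolar_idealP/(_ 0%MM) := Ig D ID0 (one_block_homogP (fun=> d) D D_hom).
  rewrite liftD; under eq_bigr do rewrite addm0; exact.
exists E, A, psi; split=> // m dm.
have lt_m : (mdeg m < d.+1)%N by rewrite dm.
by have := hpsi (BMultinom lt_m); rewrite /= dm eqxx.
Qed.
End SchemeCoordinates.

(** * Products in disjoint sets of variables *)

Section TensorProducts.
Variables (R : realType) (n k : nat).
Local Notation C := R[i].
Implicit Types (m : 'X_{1..k * n}) (mu : 'I_k -> 'X_{1..n}).

Definition index_pair (v : 'I_(k * n)) : 'I_k * 'I_n :=
  enum_val (cast_ord (esym (mxvec_cast k n)) v).

Lemma index_pairK j a : index_pair (mxvec_index j a) = (j, a).
Proof. by rewrite /index_pair /mxvec_index cast_ordK enum_rankK. Qed.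

(** The exponents of a monomial in the variables of the j-th copy; glue is the
inverse operation. *)
Definition restr m (j : 'I_k) : 'X_{1..n} :=
  [multinom m (mxvec_index j a) | a < n].

Definition glue mu : 'X_{1..k * n} :=
  [multinom mu (index_pair v).1 (index_pair v).2 | v < k * n].

Lemma glueE mu j a : glue mu (mxvec_index j a) = mu j a.
Proof. by rewrite mnmE index_pairK. Qed.

Lemma glueK mu j : restr (glue mu) j = mu j.
Proof. by apply/mnmP => a; rewrite mnmE glueE. Qed.

Lemma restrK m : glue (restr m) = m.
Proof. by apply/mnmP => v; case/mxvec_indexP: v => j a; rewrite glueE mnmE. Qed.

Lemma restrD m1 m2 j : restr (m1 + m2) j = (restr m1 j + restr m2 j)%MM.
Proof. by apply/mnmP => a; rewrite !mnmE. Qed.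

Lemma mxvec_index_inj j a j' a' :
  (mxvec_index j a == mxvec_index j' a' :> 'I_(k * n)) = (j == j') && (a == a').
Proof.
apply/eqP/andP => [/(congr1 index_pair)|[/eqP -> /eqP -> //]].
by rewrite !index_pairK => -[-> ->].
Qed.

Lemma restrU j a i :
  restr U_(mxvec_index j a) i = if i == j then U_(a)%MM else 0%MM.
Proof.
apply/mnmP => a'; rewrite mnmE mnm1E mxvec_index_inj eq_sym.
by case: eqP => // _; rewrite ?mnm1E ?mnm0E.
Qed.

Lemma big_index (T : Type) (idx : T) (op : Monoid.com_law idx)
    (P : pred 'I_(k * n)) (F : 'I_(k * n) -> T) :
  \big[op/idx]_(v | P v) F v =
  \big[op/idx]_(j < k) \big[op/idx]_(a < n | P (mxvec_index j a))
     F (mxvec_index j a).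
Proof.
pose f (ja : 'I_k * 'I_n) : 'I_(k * n) := mxvec_index ja.1 ja.2.
have f_bij : bijective f.
  exists index_pair => [[j a]|v]; first exact: index_pairK.
  by case/mxvec_indexP: v => j a; rewrite index_pairK.
rewrite (reindex f (onW_bij _ f_bij)) /=.
by rewrite pair_big_dep /=; apply: eq_big => -[].
Qed.

Lemma big_index_block (T : Type) (idx : T) (op : Monoid.com_law idx) j
    (F : 'I_(k * n) -> T) :
  \big[op/idx]_(v | copy_block v == j) F v =
  \big[op/idx]_(a < n) F (mxvec_index j a).
Proof.
rewrite big_index (bigD1 j) //= [X in op _ X]big1 ?Monoid.mulm1 => [|i ij].
  by apply: eq_bigl => a; rewrite copy_block_index eqxx.
by rewrite big_pred0 // => a; rewrite copy_block_index (negbTE ij).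
Qed.

Lemma block_deg_copy m j : block_deg (@copy_block n k) m j = mdeg (restr m j).
Proof.
rewrite /block_deg big_index_block mdegE.
by apply: eq_bigr => a _; rewrite mnmE.
Qed.

Lemma mfact_restr m : mfact R m = \prod_j mfact R (restr m j).
Proof.
rewrite /mfact big_index /= natr_prod; apply: eq_bigr => j _.
by congr (_%:R); apply: eq_bigr => a _; rewrite mnmE.
Qed.

Definition copy_vars (j : 'I_k) : n.-tuple {mpoly C[k * n]} :=
  [tuple 'X_(mxvec_index j a) | a < n].

Definition tensor (p : 'I_k -> {mpoly C[n]}) : {mpoly C[k * n]} :=
  \prod_(j < k) (p j \mPo copy_vars j).

Lemma tensorE D p : (forall j, msize (p j) <= D)%N ->
  tensor p = \sum_(f : {ffun 'I_k -> 'X_{1..n < D}})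
    (\prod_j (p j)@_(f j)) *: 'X_[glue (fun j => f j)].
Proof.
move=> pD; have pE j : p j \mPo copy_vars j = \sum_(mu : 'X_{1..n < D})
    (p j)@_mu *: \prod_(a < n) tnth (copy_vars j) a ^+ mu a.
  exact: comp_mpolywE.
rewrite /tensor (eq_bigr _ (fun j _ => pE j)) bigA_distr_bigA.
apply: eq_bigr => f _; rewrite scaler_prod; congr (_ *: _).
rewrite mpolyXE_id big_index; apply: eq_bigr => j _; apply: eq_bigr => a _.
by rewrite tnth_mktuple glueE.
Qed.

Lemma mcoeff_tensor p m : (tensor p)@_m = \prod_j (p j)@_(restr m j).
Proof.
pose D := (maxn (mdeg m).+1 (\max_(j < k) msize (p j)))%N.
have pD j : (msize (p j) <= D)%N.
  by rewrite leq_max (leq_bigmax j) orbT.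
have mD j : (mdeg (restr m j) < D)%N.
  rewrite leq_max ltnS -block_deg_copy (mdeg_block_deg (@copy_block n k) m).
  by rewrite (bigD1 j) //= leq_addr.
rewrite (tensorE pD) raddf_sum /=; under eq_bigr do rewrite mcoeffZ mcoeffX.
rewrite (bigD1 [ffun j => BMultinom (mD j)]) //=.
rewrite [X in _ + X]big1 ?addr0 => [|f].
  rewrite (_ : glue _ = m); last first.
    by rewrite -[RHS]restrK; apply/mnmP => v; rewrite !mnmE ffunE mnmE.
  by rewrite eqxx mulr1; apply: eq_bigr => j _; rewrite ffunE.
move=> fne; case: (glue _ =P m) => [gm|_]; last by rewrite mulr0.
case/eqP: fne.
by apply/ffunP => j; apply/val_inj; rewrite ffunE /= -gm glueK.
Qed.

(** A product of functionals, one for each copy, is multiplicative on products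
in disjoint variables. *)
Lemma mlift_tensor (w : 'I_k -> 'X_{1..n} -> C) p :
  mlift (fun m => \prod_j w j (restr m j) : C^o) (tensor p) =
  \prod_j mlift (w j : _ -> C^o) (p j).
Proof.
pose D := (\max_(j < k) msize (p j))%N.
have pD j : (msize (p j) <= D)%N by rewrite (leq_bigmax j).
rewrite (tensorE pD) mlift_sum (eq_bigr _ (fun j _ => mliftwE _ (pD j))).
rewrite bigA_distr_bigA; apply: eq_bigr => f _.
rewrite mliftZ mliftX big_split; congr (_ * _).
by apply: eq_bigr => j _; rewrite glueK.
Qed.

Lemma divpow_coef_tensor p m :
  divpow_coef (tensor p) m = \prod_j divpow_coef (p j) (restr m j).
Proof. by rewrite /divpow_coef mcoeff_tensor mfact_restr big_split. Qed.

Lemma tensor_multihomog d p : (forall j, p j \is d.-homog) ->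
  multihomog (@copy_block n k) (fun=> d) (tensor p).
Proof.
move=> hp m; rewrite mcoeff_msupp mcoeff_tensor => pm j; rewrite block_deg_copy.
apply: (dhomog_mf (hp j)); rewrite mcoeff_msupp; apply: contraNneq pm => pj.
by rewrite (bigD1 j) //= pj mul0r.
Qed.

End TensorProducts.

(** * Cactus rank of a combination of powers *)

Section PowersOfCharts.
Variables (R : realType) (n k M r : nat).
Local Notation C := R[i].
Variables (t : C) (E : 'I_M -> 'X_{1..n} -> 'rV[C]_r).
Variable A : 'I_M -> 'I_n -> 'M[C]_r.
Hypothesis E_mul : forall i a m, E i (U_(a) + m)%MM = E i m *m A i a.
Hypothesis A_unit : forall i, \sum_(a < n) t ^+ a *: A i a = 1%:M.

Local Notation T := ('I_M * {ffun 'I_k -> 'I_r})%type.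

(** Coordinates on the disjoint union over i of the k-th powers of the i-th
schemes: products of k coordinates of the same scheme. *)
Definition coord_product (x : T) (m : 'X_{1..k * n}) : C :=
  \prod_j E x.1 (restr m j) 0 (x.2 j).

Definition power_coord (m : 'X_{1..k * n}) : 'rV[C]_#|{: T}| :=
  \row_x coord_product (enum_val x) m.

Definition update (s : {ffun 'I_k -> 'I_r}) j z : {ffun 'I_k -> 'I_r} :=
  [ffun l => if l == j then z else s l].

(** A variable of the j-th copy acts on the j-th factor only. *)
Lemma power_coordX j a m (x : T) :
  power_coord (U_(mxvec_index j a) + m) 0 (enum_rank x) =
  \sum_z power_coord m 0 (enum_rank (x.1, update x.2 j z)) * A x.1 a z (x.2 j).
Proof.
case: x => i s; rewrite mxE enum_rankK /coord_product /= (bigD1 j) //=.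
rewrite restrD restrU eqxx.
rewrite E_mul mxE mulr_suml; apply: eq_bigr => z _.
rewrite mxE enum_rankK /coord_product /= [in RHS](bigD1 j) //=.
rewrite ffunE eqxx mulrAC.
congr (_ * _ * _); apply: eq_bigr => l lj.
by rewrite ffunE (negbTE lj) restrD restrU (negbTE lj) add0m.
Qed.

Lemma mlift_row (N s : nat) (v : 'X_{1..N} -> 'rV[C]_s) p x :
  mlift v p 0 x = mlift (fun m => v m 0 x : C^o) p.
Proof. by rewrite /mlift summxE; apply: eq_bigr => m _; rewrite mxE. Qed.

Lemma power_coord_ker v p :
  mlift power_coord p = 0 -> mlift power_coord ('X_v * p) = 0.
Proof.
case/mxvec_indexP: v => j a p0; apply/rowP => x.
rewrite -[x]enum_valK mliftXM mlift_row mxE.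
move: (enum_val x) => {}x.
under eq_mlift do rewrite power_coordX.
rewrite /mlift; under eq_bigr do rewrite scaler_sumr.
rewrite exchange_big /= big1 //= => z _.
transitivity (mlift power_coord p 0 (enum_rank (x.1, update x.2 j z)) *
  A x.1 a z (x.2 j)); last by rewrite p0 mxE mul0r.
rewrite mlift_row /mlift mulr_suml; apply: eq_bigr => m _; exact: mulrA.
Qed.

Lemma power_coord_unit i p :
  mlift power_coord
    ((\sum_(v | copy_block v == i) t ^+ (index_pair v).2 *: 'X_v) * p)
  = mlift power_coord p.
Proof.
rewrite big_index_block mulr_suml mlift_sum; apply/rowP => x.
rewrite -[x]enum_valK summxE; move: (enum_val x) => {}x.
rewrite [RHS]mlift_row /mlift.
transitivity (\sum_(a < n) \sum_(m <- msupp p)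
    p@_m * (t ^+ a * power_coord (U_(mxvec_index i a) + m) 0 (enum_rank x))).
  apply: eq_bigr => a _; rewrite -scalerAl -/(mlift _ _) mliftZ index_pairK mxE.
  rewrite mliftXM mlift_row mulr_sumr; apply: eq_bigr => m _.
  by rewrite mulrCA.
rewrite exchange_big; apply: eq_bigr => m _; rewrite -mulr_sumr; congr (_ * _).
transitivity (\sum_z power_coord m 0 (enum_rank (x.1, update x.2 i z)) *
    (1%:M : 'M[C]_r) z (x.2 i)).
  under eq_bigr do rewrite power_coordX mulr_sumr.
  rewrite exchange_big; apply: eq_bigr => z _ /=.
  rewrite -(A_unit x.1) summxE mulr_sumr; apply: eq_bigr => a _.
  by rewrite mulrCA; congr (_ * _); rewrite mxE.
rewrite (bigD1 (x.2 i)) //= [X in _ + X]big1 => [|z /negbTE zi]; last first.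
  by rewrite [X in _ * X]mxE zi mulr0.
rewrite [X in _ * X + _]mxE eqxx mulr1 addr0.
congr (power_coord m 0 (enum_rank _)).
case: x => x1 x2 /=; congr pair; apply/ffunP => l; rewrite ffunE.
by case: eqP => // ->.
Qed.

Lemma cactus_rank_sum_powers d (c : 'I_M -> C) (g : 'I_M -> {mpoly C[n]})
    (psi : 'I_M -> 'cV[C]_r) :
  (forall i, g i \is d.-homog) ->
  (forall i m, mdeg m = d -> divpow_coef (g i) m = (E i m *m psi i) 0 0) ->
  (cactus_rank (@copy_block n k) (fun=> d)
     (\sum_i c i *: tensor (fun _ : 'I_k => g i)) <= (M * r ^ k)%:R%:E)%E.
Proof.
move=> g_hom g_psi.
pose Psi : 'cV[C]_#|{: T}| := \col_x
  (fun y : T => c y.1 * \prod_j psi y.1 (y.2 j) 0) (enum_val x).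
have -> : (M * r ^ k)%N = #|{: T}|.
  by rewrite card_prod card_ffun !card_ord.
apply: (cactus_rank_of_functionals power_coord_ker power_coord_unit
  (psi := Psi)).
  apply: multihomog_sum => i; exact: tensor_multihomog.
move=> m /has_degP m_deg.
rewrite {1}/divpow_coef raddf_sum mulr_sumr /= mxE.
rewrite (reindex (@enum_rank {: T})) /=; last exact/onW_bij/enum_rank_bij.
under [RHS]eq_bigr do rewrite !mxE enum_rankK.
rewrite -(pair_bigA _ (fun i (s : {ffun 'I_k -> 'I_r}) =>
  (\prod_j E i (restr m j) 0 (s j)) * (c i * \prod_j psi i (s j) 0))) /=.
apply: eq_bigr => i _.
rewrite mcoeffZ mulrCA -/(divpow_coef _ _) divpow_coef_tensor.
under eq_bigr => j _ do rewrite g_psi ?mxE -?block_deg_copy //.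
rewrite bigA_distr_bigA mulr_sumr; apply: eq_bigr => s _.
by rewrite big_split mulrCA.
Qed.

End PowersOfCharts.

(** * Powers of a limit in the span of the powers of the family *)

Section LimitsOfMonomials.
Local Open Scope classical_set_scope.
Variables (K : numFieldType) (S : Type) (F : set_system S).
Hypothesis FF : ProperFilter F.
Variables (I T : finType) (x : S -> I -> K) (x0 : I -> K).
Hypothesis x_cvg : forall i, (x s i : K^o) @[s --> F] --> (x0 i : K^o).

Lemma cvg_monomial (a : I -> nat) :
  (\prod_i x s i ^+ a i : K^o) @[s --> F] --> (\prod_i x0 i ^+ a i : K^o).
Proof.
elim: (index_enum I) => [|i r IHr].
  rewrite big_nil; under eq_cvg do rewrite big_nil; exact: cvg_cst.
rewrite big_cons; under eq_cvg do rewrite big_cons.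
apply: (@cvgM K S F _) => //; elim: (a i) => [|e IHe].
  rewrite expr0; under eq_cvg do rewrite expr0; exact: cvg_cst.
rewrite exprS; under eq_cvg do rewrite exprS.
exact: (@cvgM K S F _).
Qed.

Lemma cvg_monomial_combination (lam : T -> K) (a : T -> I -> nat) :
  (\sum_t lam t * \prod_i x s i ^+ a t i : K^o) @[s --> F] -->
  (\sum_t lam t * \prod_i x0 i ^+ a t i : K^o).
Proof.
elim: (index_enum T) => [|t r IHr].
  rewrite big_nil; under eq_cvg do rewrite big_nil; exact: cvg_cst.
rewrite big_cons; under eq_cvg do rewrite big_cons.
apply: (@cvgD K K^o S F _) => //; apply: (@cvgM K S F _); first exact: cvg_cst.
exact: cvg_monomial.
Qed.

Lemma monomial_combination_limit0 (lam : T -> K) (a : T -> I -> nat) :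
  (\forall s \near F, \sum_t lam t * \prod_i x s i ^+ a t i = 0) ->
  \sum_t lam t * \prod_i x0 i ^+ a t i = 0.
Proof.
move=> h0; have h1 : (\sum_t lam t * \prod_i x s i ^+ a t i : K^o)
  @[s --> F] --> (0 : K^o) by exact: cvg_near_cst.
exact: (cvg_unique (@norm_hausdorff K K^o)
  (@cvg_monomial_combination lam a) h1).
Qed.

End LimitsOfMonomials.

Section SpanOfPowers.
Variables (R : realType) (n k d : nat).
Local Notation C := R[i].
Local Notation poly := {mpoly C[n]}.
Local Notation mon := 'X_{1..n < d.+1}.
Local Notation T := {ffun mon -> 'I_k.+1}.

Definition coef_monomial (p : poly) (a : T) : C :=
  \prod_(mu : mon) p@_mu ^+ a mu.

Definition coef_row (p : poly) : 'rV[C]_#|{: T}| :=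
  \row_x coef_monomial p (enum_val x).

(** The coefficient of the k-th power at m is the product of k coefficients of
p, and only depends on how often each of them occurs. *)
Lemma mcoeff_tensor_power p m : p \is d.-homog ->
  (tensor (fun _ : 'I_k => p))@_m =
  if [forall j, mdeg (restr m j) < d.+1]%N then
    coef_monomial p [ffun mu : mon => inord #|[pred j | restr m j == mu]|]
  else 0.
Proof.
move=> hp; rewrite mcoeff_tensor.
case: ifP => [/forallP lt_d|/negbT]; last first.
  rewrite negb_forall => /existsP [j]; rewrite -leqNgt => lt_d.
  rewrite (bigD1 j) //= (dhomog_nemf_coeff hp) ?mul0r // neq_ltn.
  by rewrite [X in _ || X]lt_d orbT.
rewrite (partition_big (fun j => BMultinom (lt_d j)) xpredT) //=.
apply: eq_bigr => mu _; rewrite ffunE inordK; last first.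
  by rewrite ltnS (leq_trans (max_card _)) ?card_ord.
rewrite (eq_bigr (fun=> p@_mu)) => [|j /eqP <-] //.
rewrite prodr_const; congr (_ ^+ _); exact: eq_card.
Qed.

(** The hypothesis on f says that f satisfies all linear relations between
monomials of degree at most k in each coefficient that hold on the family; the
row of these monomials at f is then a combination of rows at members of the
family, and the k-th powers depend linearly on these rows. *)
Lemma tensor_power_in_span (X : Type) (P : X -> Prop) (G : X -> poly) f :
  (forall x, P x -> G x \is d.-homog) -> f \is d.-homog ->
  (forall lam : T -> C,
    (forall x, P x -> \sum_a lam a * coef_monomial (G x) a = 0) ->
    \sum_a lam a * coef_monomial f a = 0) ->
  exists M (x : 'I_M -> X) (c : 'I_M -> C),
  [/\ (M <= k.+1 ^ #|{: mon}|)%N, forall i, P (x i) &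
      tensor (fun _ : 'I_k => f) =
        \sum_i c i *: tensor (fun _ : 'I_k => G (x i))].
Proof.
move=> G_hom f_hom f_closure.
have [M [x [Px x_free x_span]]] :=
  free_spanning_family P (fun x => coef_row (G x)).
have lamE (lam : T -> C) p :
    \sum_a lam a * coef_monomial p a
    = (coef_row p *m \col_y lam (enum_val y)) 0 0.
  rewrite mxE (reindex _ (onW_bij _ (enum_val_bij {: T}))) /=.
  by apply: eq_bigr => y _; rewrite !mxE mulrC.
have : (coef_row f <= \matrix_i coef_row (G (x i)))%MS.
  rewrite submxE; apply/eqP/rowP => z; rewrite [RHS]mxE.
  set B := cokermx _; pose lam a := B (enum_rank a) z.
  have colE p : (coef_row p *m B) 0 z = \sum_a lam a * coef_monomial p a.
    rewrite lamE !mxE; apply: eq_bigr => y _.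
    by rewrite [X in _ = _ * X]mxE /lam enum_valK.
  rewrite colE; apply: f_closure => y Py; rewrite -colE.
  by have := x_span y Py; rewrite submxE => /eqP ->; rewrite mxE.
case/submxP => D fD; exists M, x, (D 0); split=> //.
  by rewrite -(eqP x_free) (leq_trans (rank_leq_col _)) // card_ffun card_ord.
have fE a : coef_monomial f a = \sum_i D 0 i * coef_monomial (G (x i)) a.
  move/rowP: fD => /(_ (enum_rank a)); rewrite !mxE enum_rankK => ->.
  by apply: eq_bigr => i _; rewrite !mxE enum_rankK.
apply/mpolyP => m; rewrite raddf_sum /= mcoeff_tensor_power //.
under eq_bigr => i _ do rewrite mcoeffZ mcoeff_tensor_power ?G_hom //.
case: ifP => // _; last by rewrite big1 // => i _; rewrite mulr0.
Qed.

End SpanOfPowers.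

(** * Rank of a combination of powers *)

Section RankOfSums.
Variables (R : realType) (n k d M r : nat).
Local Notation C := R[i].
Hypotheses (k_gt0 : (0 < k)%N) (d_gt0 : (0 < d)%N).
Variables (l : 'I_M -> 'I_r -> {mpoly C[n]}) (c : 'I_M -> C).
Hypothesis l_lin : forall i s, linear_forms (@one_block n) ord0 (l i s).

Lemma linear_form_copy (p : {mpoly C[n]}) j :
  linear_forms (@one_block n) ord0 p ->
  linear_forms (@copy_block n k) j (p \mPo copy_vars R n j).
Proof.
move=> [a ->]; exists (fun v => a (index_pair v).2).
rewrite big_index_block raddf_sum /=.
apply: eq_big => v; first by rewrite /one_block eqxx.
by rewrite comp_mpolyZ comp_mpolyXU -tnth_nth tnth_mktuple index_pairK.
Qed.

Lemma linear_formsZ (N k' : nat) (b : 'I_N -> 'I_k') j (x : C) p :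
  linear_forms b j p -> linear_forms b j (x *: p).
Proof.
move=> [a ->]; exists (fun v => x * a v).
by rewrite scaler_sumr; apply: eq_bigr => v _; rewrite scalerA.
Qed.

Lemma ps_rank_sum_powers :
  (ps_rank (@copy_block n k) (fun=> d)
     (\sum_i c i *: tensor (fun _ : 'I_k => \sum_s l i s ^+ d))
   <= (M * r ^ k)%:R%:E)%E.
Proof.
pose T := ('I_M * {ffun 'I_k -> 'I_r})%type.
have -> : (M * r ^ k)%N = #|{: T}| by rewrite card_prod card_ffun !card_ord.
pose j0 := Ordinal k_gt0.
pose rho (i : 'I_M) : C := (d.-root (c i))%C.
(* The scalar c i is distributed as a d-th power on the first copy. *)
pose L (y : T) j := (if j == j0 then rho y.1 else 1)
  *: (l y.1 (y.2 j) \mPo copy_vars R n j).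
apply: minlength_le; exists (fun x => L (enum_val x)); split.
  by move=> x j; apply/linear_formsZ/linear_form_copy.
transitivity (\sum_(y : T) \prod_j L y j ^+ d); last first.
  by rewrite (reindex _ (onW_bij _ (enum_val_bij {: T}))).
rewrite -(pair_bigA _ (fun i s => \prod_j L (i, s) j ^+ d)) /=.
apply: eq_bigr => i _; rewrite /tensor.
have powE (j : 'I_k) : (\sum_s l i s ^+ d) \mPo copy_vars R n j =
    \sum_s (l i s \mPo copy_vars R n j) ^+ d.
  by rewrite raddf_sum; apply: eq_bigr => s _; exact: rmorphXn.
rewrite (eq_bigr _ (fun j _ => powE j)) bigA_distr_bigA scaler_sumr.
apply: eq_bigr => s _; rewrite /L /=.
rewrite [RHS](eq_bigr (fun j => ((if j == j0 then rho i else 1) ^+ d) *: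
  (l i (s j) \mPo copy_vars R n j) ^+ d)) => [|j _]; last by rewrite exprZn.
rewrite scaler_prod; congr (_ *: _); rewrite (bigD1 j0) //= /rho rootCK //.
by rewrite big1 ?mulr1 // => j /negbTE ->; rewrite expr1n.
Qed.

End RankOfSums.

(** * Dimension of the apolar algebra of a power *)

Section ApolarDimension.
Variable (R : realType).
Local Notation C := R[i].

Lemma divpow_coef_ge N (t : {mpoly C[N]}) m :
  (msize t <= mdeg m)%N -> divpow_coef t m = 0.
Proof.
by move=> /msize_mdeg_ge/memN_msupp_eq0 h; rewrite /divpow_coef h mulr0.
Qed.

Lemma apolar_dimP N (t : {mpoly C[N]}) :
  quotient_dim setT (apolar_ideal t) (apolar_dim t).
Proof.
rewrite /apolar_dim; apply: xgetPex.
pose mon := 'X_{1..N < msize t}.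
pose Phi := mlift (fun m => \row_(x < #|{: mon}|)
  divpow_coef t (m + (enum_val x : mon))).
have PhiE p : apolar_ideal t p <-> Phi p = 0.
  split=> [/apolar_idealP h|h].
    by apply/rowP => x; rewrite mlift_row mxE -[RHS](h (enum_val x : mon));
      apply: eq_mlift => m _; rewrite mxE.
  apply/apolar_idealP => m; have [lt_m|le_m] := ltnP (mdeg m) (msize t).
    transitivity (Phi p 0 (enum_rank (BMultinom lt_m : mon))).
      by rewrite mlift_row; apply: eq_mlift => m' _; rewrite mxE enum_rankK.
    by rewrite h mxE.
  rewrite /mlift big1 // => m' _; rewrite divpow_coef_ge ?scaler0 //.
  by rewrite mdegD (leq_trans le_m) ?leq_addl.
have [s [e [_ e_free e_span]]] := free_spanning_family (fun=> True) Phi.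
have setT_closed : linear_closed (setT : set {mpoly C[N]}) by [].
exists s; exact: (quotient_dim_free setT_closed (fun p _ => PhiE p) (fun=> I)
  e_free e_span).
Qed.

(** Elements of U that have a dual family of functionals vanishing on I are
independent modulo I. *)
Lemma quotient_dim_ge N (U I : set {mpoly C[N]}) r (T : finType)
    (e : T -> {mpoly C[N]}) (psi : T -> {linear {mpoly C[N]} -> C^o}) :
  quotient_dim U I r -> (forall x, U (e x)) ->
  (forall y p, I p -> psi y p = 0) ->
  (forall x y, psi y (e x) = (x == y)%:R) -> (#|T| <= r)%N.
Proof.
move=> [b [_ b_span]] Ue psiI psi_e.
have /choice [c hc] : forall x, exists c : 'rV[C]_r,
    I (e x - \sum_(s < r) c 0 s *: b s).
  by move=> x; have [c [hc _]] := b_span _ (Ue x); exists c.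
pose A : 'M[C]_(#|T|, r) := \matrix_i c (enum_val i).
pose B : 'M[C]_(r, #|T|) := \matrix_(s, j) psi (enum_val j) (b s).
apply: (@mulmx1_min _ _ _ A B); apply/matrixP => i j; rewrite !mxE.
have := psiI (enum_val j) _ (hc (enum_val i)); rewrite linearB /= psi_e.
rewrite linear_sum /= (inj_eq enum_val_inj) => /eqP.
rewrite subr_eq0 => /eqP ->.
by apply: eq_bigr => s _; rewrite linearZ !mxE.
Qed.

(** A basis e of the apolar algebra of f has a dual family w for the apolar
pairing, since the pairing of the basis with monomials has independent rows.
Products of elements of e, one for each copy, are dual to products of elements
of w. *)
Lemma apolar_dim_tensor_power n k (f : {mpoly C[n]}) :
  (apolar_dim f ^ k <= apolar_dim (tensor (fun _ : 'I_k => f)))%N.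
Proof.
set r := apolar_dim f; have [e [_ e_span]] := apolar_dimP f.
pose mon := 'X_{1..n < msize f}.
pose pair (x : mon) := mlift (fun m => divpow_coef f (m + x) : C^o).
pose G : 'M[C]_(r, #|{: mon}|) := \matrix_(s, x) pair (enum_val x) (e s).
have G_free : row_free G.
  apply: inj_row_free => v vG.
  have [c [_ c_uniq]] := e_span 0 I.
  have I00 : apolar_ideal f 0 by apply/apolar_idealP => m; rewrite mlift0.
  have c0 : c = 0.
    apply: (c_uniq 0); rewrite big1 ?subr0 // => s _.
    by rewrite mxE scale0r.
  rewrite -c0; apply/esym/(c_uniq v).
  apply/apolar_idealP => m; have [lt_m|le_m] := ltnP (mdeg m) (msize f).
    pose x : mon := BMultinom lt_m.
    rewrite sub0r -scaleN1r mliftZ mlift_sum.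
    transitivity (- (v *m G) 0 (enum_rank x)); last by rewrite vG mxE oppr0.
    rewrite scaleN1r mxE; congr (- _); apply: eq_bigr => s _.
    by rewrite mliftZ mxE enum_rankK.
  rewrite /mlift big1 // => m' _; rewrite divpow_coef_ge ?scaler0 //.
  by rewrite mdegD (leq_trans le_m) ?leq_addl.
pose B := pinvmx G.
pose w (s : 'I_r) (m : 'X_{1..n}) : C :=
  \sum_(x : mon) divpow_coef f (m + x) * B (enum_rank x) s.
have w_dual s s' : mlift (w s' : _ -> C^o) (e s) = (s == s')%:R.
  transitivity ((G *m B) s s'); last by rewrite (mulmxVp G_free) mxE.
  rewrite mxE /mlift; under eq_bigr do rewrite scaler_sumr.
  rewrite exchange_big (reindex _ (onW_bij _ (enum_val_bij {: mon}))) /=.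
  apply: eq_bigr => x _; rewrite [G _ _]mxE /pair /mlift mulr_suml enum_valK.
  by apply: eq_bigr => m _; exact: mulrA.
have -> : (r ^ k)%N = #|{: {ffun 'I_k -> 'I_r}}| by rewrite card_ffun !card_ord.
apply: (quotient_dim_ge (apolar_dimP _)
  (e := fun y : {ffun 'I_k -> 'I_r} => tensor (fun j => e (y j)))
  (psi := fun y => mlift (fun m => \prod_j w (y j) (restr m j) : C^o))) => //.
- move=> y p /apolar_idealP hp; rewrite /w.
  transitivity (\sum_(g : {ffun 'I_k -> mon})
     mlift (fun m => divpow_coef (tensor (fun _ : 'I_k => f))
       (m + glue (fun j => g j)) : C^o) p * \prod_j B (enum_rank (g j)) (y j)).
    rewrite /mlift; under [RHS]eq_bigr do rewrite mulr_suml.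
    rewrite exchange_big; apply: eq_bigr => m _ /=.
    rewrite bigA_distr_bigA scaler_sumr; apply: eq_bigr => g _.
    rewrite -[RHS]mulrA; congr (_ * _).
    rewrite big_split; congr (_ * _); rewrite divpow_coef_tensor.
    by apply: eq_bigr => j _; rewrite restrD glueK.
  by rewrite big1 // => g _; rewrite hp mul0r.
move=> x y; transitivity (\prod_j mlift (w (y j) : _ -> C^o) (e (x j))).
  exact: (mlift_tensor (fun j => w (y j)) (fun j => e (x j))).
under eq_bigr do rewrite w_dual.
have [->|ne] := eqVneq x y; first by rewrite big1 // => j _; rewrite eqxx.
have [j xyj] : exists j, x j != y j.
  apply: contrapT => nj; case/eqP: ne; apply/ffunP => j.
  by apply/eqP/negPn/negP => xyj; apply: nj; exists j.
by rewrite (bigD1 j) //= (negbTE xyj) mul0r.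
Qed.

End ApolarDimension.

(** * Exponential against polynomial growth *)

Section Growth.

Lemma bernoulli_nat q m : (q ^ m * (q + m) <= q.+1 ^ m * q)%N.
Proof.
elim: m => [|m IHm]; first by rewrite !expn0 addn0.
rewrite !expnS -[leqRHS]mulnA; apply: leq_trans (leq_mul (leqnn q.+1) IHm).
rewrite [leqRHS]mulnCA -mulnA [leqLHS]mulnCA; apply: leq_mul => //; nia.
Qed.

(** If a > q > 0 then a^q >= 2 q^q by Bernoulli's inequality, so the exponents
k = q j give 2^j <= (q j + 1)^D; for j = 2^i this bounds 2^i linearly in i. *)
Lemma subexponential_root a q D :
  (forall k, (1 <= k)%N -> (a ^ k <= k.+1 ^ D * q ^ k)%N) -> (a <= q)%N.
Proof.
move=> h; rewrite leqNgt; apply/negP => lt_qa.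
have q_gt0 : (0 < q)%N.
  rewrite lt0n; apply/negP => /eqP q0; have := h 1%N isT.
  by rewrite q0 !expn1 muln0; lia.
have two_q : (2 * q ^ q <= a ^ q)%N.
  apply: (@leq_trans (q.+1 ^ q)); last by rewrite leq_exp2r.
  rewrite -(leq_pmul2r q_gt0); apply: leq_trans (bernoulli_nat q q); nia.
have pow2 j : (1 <= j)%N -> (2 ^ j <= (q * j).+1 ^ D)%N.
  move=> j_gt0; rewrite -(@leq_pmul2r (q ^ (q * j))) ?expn_gt0 ?q_gt0 //.
  apply: leq_trans (h (q * j)%N _); last by rewrite muln_gt0 q_gt0.
  by rewrite !expnM -expnMn leq_exp2r.
have lin i : (2 ^ i <= (q + i + 1) * D)%N.
  rewrite -(@leq_exp2l 2) // expnM; apply: leq_trans (pow2 (2 ^ i)%N _) _.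
    by rewrite expn_gt0.
  have lt_q := ltn_expl q (isT : 1 < 2)%N.
  have pos : (0 < 2 ^ i)%N by rewrite expn_gt0.
  have : ((q * 2 ^ i).+1 <= 2 ^ (q + i + 1))%N by rewrite !expnD expn1; nia.
  by case: D {h pow2} => // D; rewrite leq_exp2r.
(* i = 2 s with s = D (q + 2) is large enough, as 2^(2s) >= (s + 1)^2. *)
have /(_ (D * q.+2)%N) := fun s => lin (s + s)%N.
have := ltn_expl (D * q.+2) (isT : 1 < 2)%N; rewrite expnD.
set s := (D * q.+2)%N; set z := (2 ^ s)%N => lt_sz le_z.
have : (s.+1 * s.+1 <= z * z)%N by apply: leq_mul.
rewrite /s in le_z *; nia.
Qed.

End Growth.

(** * Lower bounds for the border ranks *)

Lemma exists_nonroot (K : numFieldType) (p : {poly K}) :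
  p != 0 -> exists t, p.[t] != 0.
Proof.
move=> p_neq0; apply: contrapT => nt.
pose rs : seq K := [seq i%:R | i <- iota 0 (size p)].
have rs_uniq : uniq rs.
  by rewrite map_inj_uniq ?iota_uniq // => i j /eqP; rewrite eqr_nat => /eqP.
have rs_root : all (root p) rs.
  apply/allP => t _; rewrite /root; apply/negPn/negP => pt; apply: nt.
  by exists t.
have := max_poly_roots p_neq0 rs_root rs_uniq.
by rewrite size_map size_iota ltnn.
Qed.

Section Border.
Variables (R : realType) (n d : nat).
Local Notation C := R[i].
Local Notation poly := {mpoly C[n.+1]}.

Lemma dim_ratio_le (a delta r D : nat) :
  (forall k, (1 <= k)%N -> exists ak M : nat,
     [/\ (a ^ k <= ak)%N, (M <= k.+1 ^ D)%N &
        ((ak%:R / (delta ^ k)%:R)%:E <= (M * r ^ k)%:R%:E :> \bar R)%E]) ->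
  ((a%:R / delta%:R)%:E <= r%:R%:E :> \bar R)%E.
Proof.
move=> h; rewrite lee_fin; have [->|delta_neq0] := eqVneq delta 0%N.
  by rewrite invr0 mulr0 ler0n.
have delta_gt0 : (0 < delta)%N by rewrite lt0n.
rewrite ler_pdivrMr ?ltr0n // -natrM ler_nat.
apply: (@subexponential_root _ _ D) => k /h [ak [M [le_ak le_M]]].
rewrite lee_fin ler_pdivrMr ?ltr0n ?expn_gt0 ?delta_gt0 // -natrM ler_nat.
move=> le_k.
apply: leq_trans le_ak (leq_trans le_k _).
by rewrite -mulnA -expnMn leq_mul2r le_M orbT.
Qed.

(** Linear relations between monomials in the coefficients pass to the limit. *)
Lemma border_tensor_power (F : R -> poly) (f : poly) k :
  (forall e, 0 < e -> F e \is d.-homog) -> f \is d.-homog ->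
  (forall m, ((F e)@_m : C^o) @[e --> 0^'+] --> (f@_m : C^o))%classic ->
  exists M (x : 'I_M -> R) (c : 'I_M -> C),
  [/\ (M <= k.+1 ^ #|{: 'X_{1..n.+1 < d.+1}}|)%N, forall i, 0 < x i &
      tensor (fun _ : 'I_k => f) =
        \sum_i c i *: tensor (fun _ : 'I_k => F (x i))].
Proof.
move=> F_hom f_hom F_cvg.
apply: (tensor_power_in_span (P := fun e => 0 < e) F_hom f_hom) => lam lam0.
pose x e (mu : 'X_{1..n.+1 < d.+1}) : C := (F e)@_mu.
pose alpha (a : {ffun 'X_{1..n.+1 < d.+1} -> 'I_k.+1}) mu : nat := a mu.
apply: (@monomial_combination_limit0 C R (0^'+)%classic _ _ _ x
  (fun mu => f@_mu) _ lam alpha) => [mu|]; first exact: F_cvg.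
near=> e; apply: lam0; near: e; exact: nbhs_right_gt.
Unshelve. all: by end_near. Qed.

Lemma border_rank_ge (delta a : nat) (f : poly) :
  f \is d.-homog ->
  (forall k, (1 <= k)%N -> exists2 ak : nat, (a ^ k <= ak)%N &
     ((ak%:R / (delta ^ k)%:R)%:E <= ps_rank (@copy_block n.+1 k)
        (fun=> d) (tensor (fun _ : 'I_k => f)))%E) ->
  ((a%:R / delta%:R)%:E <= border_rank d f)%E.
Proof.
move=> f_hom star; apply: le_ereal_inf_tmp => _ [r [F [F_rank F_cvg]] <-].
have F_dec e : 0 < e -> exists2 l : 'I_r -> poly,
    forall s, linear_forms (@one_block n.+1) ord0 (l s) &
    F e = \sum_s l s ^+ d.
  move=> /F_rank [_ /minlength_attained [l [l_lin ->]]].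
  by exists (fun s => l s ord0) => //; apply: eq_bigr => s _; rewrite big_ord1.
apply: (@dim_ratio_le _ _ _ #|{: 'X_{1..n.+1 < d.+1}}|) => k k_gt0.
have [ak le_ak star_k] := star k k_gt0; exists ak.
(* In degree 0 the scalars cannot be absorbed in the linear forms; but there
   a form of rank r is the constant r, so the family is constant. *)
have [d0|d_gt0] := posnP d.
  exists 1%N; split; rewrite ?expn_gt0 //; apply: le_trans star_k _.
  have fE : f = r%:R.
    apply/mpolyP => m.
    apply: (@cvg_unique C^o (@norm_hausdorff _ _) _ _ _ _ (F_cvg m)).
    apply: cvg_near_cst; near=> e.
    have [|l _ ->] := F_dec e; first by near: e; exact: nbhs_right_gt.
    by rewrite d0; under eq_bigr do rewrite expr0; rewrite sumr_const card_ord.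
  apply: minlength_le; exists (fun _ _ => 0); split.
    move=> s j; exists (fun=> 0); rewrite big1 // => v _; exact: scale0r.
  rewrite d0; under eq_bigr => s _ do rewrite big1 ?expr0 //.
  rewrite sumr_const card_ord mul1n natrX fE /tensor.
  under eq_bigr do rewrite -mpolyC_nat comp_mpolyC mpolyC_nat.
  by rewrite prodr_const card_ord.
have [M [x [c [le_M x_gt0 fE]]]] := border_tensor_power
  k (fun e e_gt0 => (F_rank e e_gt0).1) f_hom F_cvg.
exists M; split=> //; apply: le_trans star_k _.
have /choice [l hl] : forall i, exists l : 'I_r -> poly,
    (forall s, linear_forms (@one_block n.+1) ord0 (l s)) /\
    F (x i) = \sum_s l s ^+ d.
  by move=> i; have [l l_lin lE] := F_dec _ (x_gt0 i); exists l.
rewrite fE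
  (eq_bigr (fun i => c i *: tensor (fun _ : 'I_k => \sum_s l i s ^+ d))).
  by apply: ps_rank_sum_powers => // i s; case: (hl i).
by move=> i _; case: (hl i) => _ <-.
Unshelve. all: by end_near. Qed.

Lemma border_cactus_rank_ge (delta a : nat) (f : poly) :
  f \is d.-homog ->
  (forall k, (1 <= k)%N -> exists2 ak : nat, (a ^ k <= ak)%N &
     ((ak%:R / (delta ^ k)%:R)%:E <= cactus_rank (@copy_block n.+1 k)
        (fun=> d) (tensor (fun _ : 'I_k => f)))%E) ->
  ((a%:R / delta%:R)%:E <= border_cactus_rank d f)%E.
Proof.
move=> f_hom star; apply: le_ereal_inf_tmp => _ [r [F [F_rank F_cvg]] <-].
apply: (@dim_ratio_le _ _ _ #|{: 'X_{1..n.+1 < d.+1}}|) => k k_gt0.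
have [ak le_ak star_k] := star k k_gt0; exists ak.
have [M [x [c [le_M x_gt0 fE]]]] := border_tensor_power
  k (fun e e_gt0 => (F_rank e e_gt0).1) f_hom F_cvg.
exists M; split=> //; apply: le_trans star_k _.
have /choice [P hP] : forall i, exists P : {poly C}, P != 0 /\
    forall t, P.[t] != 0 ->
    exists (E : 'X_{1..n.+1} -> 'rV[C]_r) (A : 'I_n.+1 -> 'M[C]_r)
      (psi : 'cV[C]_r),
    [/\ forall v m, E (U_(v) + m)%MM = E m *m A v,
        \sum_(v < n.+1) t ^+ v *: A v = 1%:M &
        forall m, mdeg m = d -> divpow_coef (F (x i)) m = (E m *m psi) 0 0].
  move=> i.
  have [_ /minlength_attained [I [I_scheme I_span]]] := F_rank _ (x_gt0 i).
  by have [P P_neq0 hP] := exists_scheme_coordinates I_scheme I_span; exists P.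
(* One hyperplane that avoids all the schemes. *)
have [t] : exists t, (\prod_i P i).[t] != 0.
  by apply: exists_nonroot; apply/prodf_neq0 => i _; case: (hP i).
rewrite horner_prod => /prodf_neq0 Pt.
have /choice [E hE] := fun i => (hP i).2 t (Pt i isT).
have /choice [A hA] := hE; have /choice [psi hpsi] := hA.
rewrite fE; apply: (@cactus_rank_sum_powers _ _ _ _ _ t E A _ _ _ _ _ psi) => i.
- by move=> v m; case: (hpsi i).
- by case: (hpsi i).
- exact: (F_rank _ (x_gt0 i)).1.
- by case: (hpsi i).
Qed.

End Border.

Theorem theorem1p1 (R : realType) (n d delta : nat) (f : {mpoly R[i][n.+1]})
    (f_homog : f \is d.-homog) (f_neq0 : f != 0)
    (f_gen : generated_in (@one_block n.+1) (fun=> delta) (apolar_ideal f)) :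
  ((forall k : nat, (1 <= k)%N ->
      (((apolar_dim (tensor_power k f))%:R / (delta ^ k)%:R)%:E
         <= ps_rank (@copy_block n.+1 k) (fun=> d) (tensor_power k f))%E) ->
   (((apolar_dim f)%:R / delta%:R)%:E <= border_rank d f)%E)
  /\
  ((forall k : nat, (1 <= k)%N ->
      (((apolar_dim (tensor_power k f))%:R / (delta ^ k)%:R)%:E
         <= cactus_rank (@copy_block n.+1 k) (fun=> d) (tensor_power k f))%E) ->
   (((apolar_dim f)%:R / delta%:R)%:E <= border_cactus_rank d f)%E).
Proof.
split=> star.
  apply: border_rank_ge => // k k_gt0.
  exists (apolar_dim (tensor_power k f)); last exact: star.
  exact: apolar_dim_tensor_power.
apply: border_cactus_rank_ge => // k k_gt0.
exists (apolar_dim (tensor_power k f)); last exact: star.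
exact: apolar_dim_tensor_power.
Qed.
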